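(* Let $F_r$ be the free group of finite rank $r\geqslant 2$, let $\theta:F_r\to F_r$ be an injective endomorphism, and let $G=\langle F_r,t\mid txt^{-1}=\theta(x)\text{ for all }x\in F_r\rangle$ be the corresponding (ascending) HNN extension. If $G$ contains a subgroup isomorphic to $BS(1,d)$ for some integer $d$ with $|d|\geqslant 2$, then there is a finite index subgroup $H$ of $G$ and a prime $p$ such that the rank (dimension over $\mathbb{F}_p$) of $H_1(H,\mathbb{F}_p)$ is at least $3$.
   Context: $BS(1,d)=\langle a,s\mid sas^{-1}=a^d\rangle$ is the Baumslag–Solitar group. *)

(* Defs.v *)
From HB Require Import structures.
From mathcomp Require Import all_boot all_order all_algebra.
From mathcomp Require Import finmap boolp.
From mathcomp.multinomials Require Import monalg.

Set Implicit Arguments.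
Unset Strict Implicit.
Unset Printing Implicit Defensive.

(* (x, true) stands for the letter x, and (x, false) for x^-1. *)
Definition word (X : Type) := seq (X * bool).

Definition word_inv (X : Type) (u : word X) : word X :=
  rev [seq (l.1, ~~ l.2) | l <- u].

(* The congruence of the free monoid of words generated by the cancellations
   x x^-1 = x^-1 x = 1 and by the relations u = v for [R u v]. *)
Inductive pres_cong (X : Type) (R : word X -> word X -> Prop) :
    word X -> word X -> Prop :=
  | PresRel u v : R u v -> pres_cong R u v
  | PresCancel x b : pres_cong R [:: (x, b); (x, ~~ b)] [::]
  | PresRefl u : pres_cong R u u
  | PresSym u v : pres_cong R u v -> pres_cong R v u
  | PresTrans v u w : pres_cong R u v -> pres_cong R v w -> pres_cong R u w
  | PresCat u u' v v' :
      pres_cong R u u' -> pres_cong R v v' -> pres_cong R (u ++ v) (u' ++ v').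

Section Presented.
Local Open Scope quotient_scope.
Variables (X : choiceType) (R : word X -> word X -> Prop).

Definition pres_rel : rel (word X) := fun u v => `[< pres_cong R u v >].

Lemma pres_rel_equiv : equiv_class_of pres_rel.
Proof.
split=> [u|u v|v u w]; first exact/asboolP/PresRefl.
- by apply/idP/idP => /asboolP uv; apply/asboolP/PresSym.
- by move=> /asboolP uv /asboolP vw; apply/asboolP/(PresTrans uv vw).
Qed.

Canonical pres_equiv := EquivRelPack pres_rel_equiv.

Definition presented := {eq_quot pres_equiv}.

HB.instance Definition _ := EqQuotient.on presented.
HB.instance Definition _ := Choice.on presented.

Definition pres_class (u : word X) : presented := \pi_presented u.

Lemma pres_classP u v : pres_class u = pres_class v <-> pres_cong R u v.
Proof.
split=> [/eqmodP /asboolP //|uv].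
by apply/eqmodP/asboolP.
Qed.

Lemma pres_class_repr (x : presented) : pres_class (repr x) = x.
Proof. exact: reprK. Qed.

Definition pres_one : presented := pres_class [::].
Definition pres_mul (x y : presented) : presented :=
  pres_class (repr x ++ repr y).
Definition pres_inv (x : presented) : presented :=
  pres_class (word_inv (repr x)).

Lemma pres_mulE u v :
  pres_mul (pres_class u) (pres_class v) = pres_class (u ++ v).
Proof. by apply/pres_classP/PresCat; apply/pres_classP/pres_class_repr. Qed.

Lemma pres_cong_invr u : pres_cong R (u ++ word_inv u) [::].
Proof.
rewrite /word_inv; elim: u => [|[x b] u IHu] /=; first exact: PresRefl.
rewrite rev_cons -cats1 catA -cat1s.
apply: (PresTrans _ (PresCancel R x b)).
rewrite -[X in pres_cong R _ X]/([:: (x, b)] ++ ([::] ++ [:: (x, ~~ b)])).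
by apply: PresCat; [exact: PresRefl | apply: PresCat => //; exact: PresRefl].
Qed.

Lemma pres_cong_invl u : pres_cong R (word_inv u ++ u) [::].
Proof.
have {2}-> : u = word_inv (word_inv u); last exact: pres_cong_invr.
rewrite /word_inv map_rev revK -map_comp -[LHS]map_id; apply: eq_map.
by case=> x b /=; rewrite negbK.
Qed.

Lemma pres_mulA : associative pres_mul.
Proof.
move=> x y z; rewrite -(pres_class_repr x) -(pres_class_repr y).
by rewrite -(pres_class_repr z) !pres_mulE catA.
Qed.

Lemma pres_mul1 : left_id pres_one pres_mul.
Proof. by move=> x; rewrite -(pres_class_repr x) pres_mulE. Qed.

Lemma pres_mulr1 : right_id pres_one pres_mul.
Proof. by move=> x; rewrite -(pres_class_repr x) pres_mulE cats0. Qed.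

Lemma pres_mulV : left_inverse pres_one pres_inv pres_mul.
Proof.
move=> x; rewrite -{2}(pres_class_repr x) pres_mulE.
exact/pres_classP/pres_cong_invl.
Qed.

Lemma pres_mulrV : right_inverse pres_one pres_inv pres_mul.
Proof.
move=> x; rewrite -{1}(pres_class_repr x) pres_mulE.
exact/pres_classP/pres_cong_invr.
Qed.

HB.instance Definition _ :=
  isGroup.Build presented pres_mulA pres_mul1 pres_mulr1 pres_mulV pres_mulrV.

End Presented.

Definition free_group (r : nat) : groupType :=
  presented (fun _ _ : word 'I_r => False).

(* The letter [Some x] is the element x of F and [None] is the stable letter t;
   the first family of relations is the multiplication table of F. *)
Inductive hnn_rel (F : groupType) (theta : F -> F) :
    word (option F) -> word (option F) -> Prop :=
  | HnnMul x y :
      hnn_rel theta [:: (Some x, true); (Some y, true)]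
                    [:: (Some (x * y)%g, true)]
  | HnnConj x :
      hnn_rel theta [:: (None, true); (Some x, true); (None, false)]
                    [:: (Some (theta x), true)].

Definition hnn (F : groupType) (theta : F -> F) : groupType :=
  presented (hnn_rel theta).

Definition letter_exp (X : Type) (x : X) (d : int) : word X :=
  nseq `|d|%N (x, (0 <= d)%R).

(* The letters are a = true and s = false. *)
Inductive bs1_rel (d : int) : word bool -> word bool -> Prop :=
  | BS1Conj :
      bs1_rel d [:: (false, true); (true, true); (false, false)]
                (letter_exp true d).

Definition baumslag_solitar1 (d : int) : groupType := presented (bs1_rel d).

Section Subgroup.
Variables (G : groupType) (H : groupClosed G).

Definition subgroup := {x : G | x \in H}.

HB.instance Definition _ := [isSub of subgroup for @sval G _].
HB.instance Definition _ := [Choice of subgroup by <:].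

Lemma subgroup_closed : group_closed (fun x : G => x \in H).
Proof.
split=> [|x y xH yH]; first exact: (@gpred1 G H).
have {}xH : x \in H := xH; have {}yH : y \in H := yH.
suff : (x / y)%g \in H by [].
exact: (@gpredM G H _ _ xH (@gpredVr G H _ yH)).
Qed.

HB.instance Definition _ :=
  SubChoice_isSubGroup.Build G _ subgroup subgroup_closed.

Definition finite_index : Prop :=
  exists s : seq G, forall g, exists2 x, x \in s & (x^-1 * g)%g \in H.

End Subgroup.

(* Homology with trivial coefficients, computed by the inhomogeneous bar
   complex. *)

Section Homology.
Local Open Scope ring_scope.
Variables (G : groupType) (k : fieldType).

Definition bar_chain (n : nat) := {malg k[{ffun 'I_n -> G}]}.

(* With g = [g_0 | ... | g_n], the 0-th face drops g_0, the last one drops g_n,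
   and the i-th one for 0 < i <= n replaces g_(i-1), g_i by their product. *)
Definition bar_face n (i : 'I_n.+2) (g : {ffun 'I_n.+1 -> G}) :
    {ffun 'I_n -> G} :=
  [ffun j : 'I_n =>
     if (j.+1 < i)%N then g (widen_ord (leqnSn n) j)
     else if j.+1 == i then (g (widen_ord (leqnSn n) j) * g (lift ord0 j))%g
     else g (lift ord0 j)].

Definition bar_diff n (c : bar_chain n.+1) : bar_chain n :=
  \sum_(g <- msupp c) \sum_(i < n.+2)
    ((-1) ^+ i * c@_g) *: << bar_face i g >>.

Definition bar_cycle n : bar_chain n -> Prop :=
  if n is n'.+1 then fun c => bar_diff c = 0 else fun=> True.

Definition bar_boundary n (c : bar_chain n) : Prop :=
  exists b : bar_chain n.+1, bar_diff b = c.

(* The k-vector space H_n(G, k) of cycles modulo boundaries has dimension at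
   least m: it contains m linearly independent classes. *)
Definition homology_dim_ge (n m : nat) : Prop :=
  exists z : 'I_m -> bar_chain n,
    (forall i, bar_cycle (z i)) /\
    forall a : 'I_m -> k,
      bar_boundary (\sum_(i < m) a i *: z i) -> forall i, a i = 0.

End Homology.

(* Main.v *)
(** The group G is mapped to a finite group in which an elementary abelian section
of rank three is visible.  Evaluate words at 2x2 matrices M_x over the dual numbers
R[eps], where R is a polynomial ring over F_p whose variables are the entries of
the M_x; the inverse of M_x is replaced by its adjugate, which conjugation does
not notice.  The endomorphism theta induces a polynomial self-map phi of the affine
space Spec R, and (Borisov-Sapir) as soon as a polynomial g does not vanish
identically on the image of phi^n, n = dim R, some point A over a finite field L
satisfies g(A) <> 0 and phi(A) = Fr(A) for a power Fr of the Frobenius.  Hence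
x |-> conjugation by A_x and t |-> Fr^-1 define an action of G on the finite set
M_2(L[eps]).

Consider the elements of G acting as conjugation by some 1 + eps Y; they form a
subgroup H of finite index, and [Y, _] is an additive function on H.  If D is the
value of a word w, a high power of D has the form 1 + eps (alpha + beta D_0) with
beta nonzero as soon as the eps-derivative of tr(D)^2 / det(D) and the discriminant
of D_0 do not vanish.  The powers of x_0, x_1 and x_0 x_1 so obtained are independent
modulo the kernel of this additive function provided that the additive commutator
of the values of x_0 and x_1 is invertible, which follows from the nonvanishing of
the discriminant of the value of [x_0, x_1].

That these conditions hold on the image of phi^n is seen by specialising
M_x to T P_x + adj P_x with P_x of rank one: the trace of a cyclically reduced word
of length n is then a polynomial of degree n in T. *)

Require Import Defs.
From HB Require Import structures.
From mathcomp Require Import all_boot all_order all_algebra all_fingroup all_field.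
From mathcomp Require Import boolp.
From mathcomp.multinomials Require Import mpoly.
From mathcomp Require finmap.
From mathcomp.multinomials Require monalg.
From mathcomp Require Import ring zify.

Set Implicit Arguments.
Unset Strict Implicit.
Unset Printing Implicit Defensive.

Import GRing.Theory.
Local Open Scope ring_scope.

(** * Points sent to their Frobenius image *)

Section FrobeniusIdeal.
Variables (k : fieldType) (n : nat) (Q : nat) (f : 'I_n -> {mpoly k[n]}).
Hypothesis size_f : forall i, (msize (f i) <= Q)%N.
Implicit Types (g h : {mpoly k[n]}).

Definition frob_gen i : {mpoly k[n]} := 'X_i ^+ Q - f i.

(** Its zeros over an extension of k are the points that the map f sends to their coordinatewise
    Q-th powers. *)
Definition frob_ideal h :=
  exists c : 'I_n -> {mpoly k[n]}, h = \sum_i c i * frob_gen i.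

Lemma frob_ideal0 : frob_ideal 0.
Proof. by exists (fun=> 0); rewrite big1 // => i _; rewrite mul0r. Qed.

Lemma frob_idealD g h : frob_ideal g -> frob_ideal h -> frob_ideal (g + h).
Proof.
move=> [c ->] [d ->]; exists (fun i => c i + d i); rewrite -big_split.
by apply: eq_bigr => i _; rewrite mulrDl.
Qed.

Lemma frob_idealMr g h : frob_ideal h -> frob_ideal (g * h).
Proof.
move=> [c ->]; exists (fun i => g * c i); rewrite mulr_sumr.
by apply: eq_bigr => i _; rewrite mulrA.
Qed.

Lemma frob_idealB g h : frob_ideal g -> frob_ideal h -> frob_ideal (g - h).
Proof.
by move=> Ig Ih; rewrite -mulN1r; apply: frob_idealD => //; apply: frob_idealMr.
Qed.

Lemma frob_ideal_gen i : frob_ideal (frob_gen i).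
Proof.
exists (fun j => (j == i)%:R); rewrite (bigD1 i) //= eqxx mul1r big1 ?addr0 //.
by move=> j /negPf ->; rewrite mul0r.
Qed.

(** For f_i nonzero [size_f] means deg f_i < Q, so X_i^Q dominates; when Q = 0 it forces f_i = 0 and
    the generator is 1. *)
Lemma mlead_frob_gen i : mlead (frob_gen i) = (U_(i) *+ Q)%MM /\ frob_gen i != 0.
Proof.
have Q0 : (0 < Q)%N -> (mlead (f i) < (U_(i) *+ Q)%MM)%O.
  move=> Q0; apply: lt_mdeg_ltmc; rewrite mdegMn mdeg1 mul1n.
  have [->|fi0] := eqVneq (f i) 0; first by rewrite mlead0 mdeg0.
  by apply: leq_trans (size_f i); rewrite -(mlead_deg fi0).
have lead : mlead (frob_gen i) = (U_(i) *+ Q)%MM.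
  rewrite /frob_gen mpolyXn; case: (posnP Q) => [Q0'|Qpos].
    have -> : f i = 0 by apply/eqP; rewrite -msize_poly_eq0 -leqn0 -Q0' size_f.
    by rewrite subr0 mleadXm.
  by rewrite mleadDl ?mleadXm // mleadN Q0.
split=> //; case: (posnP Q) => [Q0'|Qpos].
  have fi0 : f i = 0 by apply/eqP; rewrite -msize_poly_eq0 -leqn0 -Q0' size_f.
  by rewrite /frob_gen fi0 Q0' expr0 subr0 oner_eq0.
apply/eqP => g0; move: lead; rewrite g0 mlead0 => /esym/eqP.
rewrite -mdeg_eq0 mdegMn mdeg1 mul1n => /eqP Q0'.
by rewrite Q0' in Qpos.
Qed.

Lemma mcoeffX_mul_small (m m' : 'X_{1..n}) (p : {mpoly k[n]}) i :
  (m' i < m i)%N -> ('X_[m] * p)@_m' = 0.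
Proof.
move=> lt; apply: memN_msupp_eq0; rewrite mulrC (perm_mem (msuppMX _ _)).
apply/negP => /mapP [m1 _ E]; move: lt; rewrite E mnmDE; lia.
Qed.

(* The functional sending [g] to the coefficient of [\prod_i X_i^(QK-1)] in
   [g * \prod_i G_i], with [G_i = (X_i^(QK) - f_i^K) / (X_i^Q - f_i)], is the
   residue of [g / \prod_i (X_i^Q - f_i)]; it kills the ideal for K large. *)
Lemma frob_ideal_reduced h :
  h != 0 -> (forall i, mlead h i < Q)%N -> ~ frob_ideal h.
Proof.
move=> h0 hQ [c hE].
(* This raises every leading exponent to exactly Q-1, so that multiplying by the G_i yields leading
   exponents QK-1. *)
pose h' := h * 'X_[[multinom (Q.-1 - mlead h i)%N | i < n]].
have Xn0 m : 'X_[m] != 0 :> {mpoly k[n]}.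
  by rewrite -msize_poly_eq0 msizeX.
have h'0 : h' != 0 by rewrite mulf_neq0.
have lead_h' : mlead h' = [multinom Q.-1 | i < n].
  rewrite mleadM // mleadXm; apply/mnmP => i.
  by rewrite mnmDE !mnmE subnKC // -ltnS (leq_trans (hQ i)) ?leqSpred.
have [C h'E] : exists C : 'I_n -> {mpoly k[n]}, h' = \sum_i C i * frob_gen i.
  by rewrite /h' mulrC; apply: frob_idealMr; exists c.
pose K := (\sum_i msize (C i) + n).+2.
pose G i := \sum_(j < K) ('X_i ^+ Q) ^+ (K.-1 - j) * f i ^+ j.
have GE i : frob_gen i * G i = ('X_i ^+ Q) ^+ K - f i ^+ K.
  by rewrite /frob_gen subrXX.
case: (posnP n) => [n0|npos].
  have : h' = 0 by rewrite h'E big1 // => i; move: (ltn_ord i); rewrite {2}n0.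
  by move/eqP; rewrite (negPf h'0).
have Qpos : (0 < Q)%N by apply: leq_trans (hQ (Ordinal npos)).
have lead_XfK i : mlead (('X_i ^+ Q) ^+ K - f i ^+ K) = (U_(i) *+ (Q * K))%MM.
  rewrite -exprM mpolyXn mleadDl ?mleadXm // mleadN.
  apply: lt_mdeg_ltmc; rewrite mdegMn mdeg1 mul1n.
  have [->|fi0] := eqVneq (f i) 0; first by rewrite expr0n mlead0 mdeg0 muln_gt0 Qpos.
  rewrite mleadX // mdegMn ltn_pmul2r //.
  by apply: leq_trans (size_f i); rewrite -(mlead_deg fi0).
have XfK0 i : ('X_i ^+ Q) ^+ K - f i ^+ K != 0.
  apply/eqP => e; move: (lead_XfK i); rewrite e mlead0 => /esym/eqP.
  by rewrite -mdeg_eq0 mdegMn mdeg1 mul1n muln_eq0 /= orbF -leqn0 leqNgt Qpos.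
have G0 i : G i != 0.
  by apply/eqP => e; move: (XfK0 i); rewrite -GE e mulr0 eqxx.
have lead_G i : mlead (G i) = (U_(i) *+ (Q * K.-1))%MM.
  have [lg g0] := mlead_frob_gen i.
  have := lead_XfK i; rewrite -GE mleadM // lg => E.
  apply/mnmP => j; have := congr1 (fun m : 'X_{1..n} => m j) E.
  rewrite mnmDE !mulmnE /K /=.
  set u := U_(i)%MM j; set x := \sum_i _; set z := mlead _ j.
  by move: u x z => u x z; nia.
pose mu := [multinom (Q * K).-1 | i < n].
have lead_all : mlead (h' * \prod_i G i) = mu.
  rewrite mleadM //; last by apply/prodf_neq0.
  rewrite mlead_prod // lead_h'; apply/mnmP => j.
  rewrite mnmDE !mnmE mnm_sumE (bigD1 j) //= big1 => [|i ij].
    rewrite lead_G mulmnE mnm1E eqxx addn0 mul1n /K /=; nia.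
  by rewrite lead_G mulmnE mnm1E (negPf ij).
(* Each summand becomes C_i P (X_i^(QK) - f_i^K). The first part has too large an exponent of X_i to
   meet [mu]; the second has total degree below that of [mu], by the choice of K. *)
have coef0 : (h' * \prod_i G i)@_mu = 0.
  rewrite h'E mulr_suml raddf_sum big1 //= => i _.
  rewrite (bigD1 i) //=; set P := \prod_(_ | _) _.
  rewrite [LHS](_ : _ = (frob_gen i * G i * (C i * P))@_mu); last first.
    by congr (_@__); ring.
  rewrite GE mulrBl mcoeffB -exprM mpolyXn (@mcoeffX_mul_small _ _ _ i); last first.
    rewrite mulmnE mnm1E eqxx mnmE mul1n prednK // muln_gt0 Qpos //.
  rewrite sub0r memN_msupp_eq0 ?oppr0 //; apply: msize_mdeg_ge.
  have mdeg_mu : mdeg mu = (n * (Q * K).-1)%N.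
    rewrite mdegE (eq_bigr (fun=> (Q * K).-1)) => [|j _]; last by rewrite mnmE.
    by rewrite sum_nat_const card_ord.
  rewrite mdeg_mu.
  have P0 : P != 0 by apply/prodf_neq0.
  have [->|fi0] := eqVneq (f i) 0; first by rewrite expr0n mul0r mmeasure0.
  have [->|Ci0] := eqVneq (C i) 0; first by rewrite mul0r mulr0 mmeasure0.
  have CP0 : C i * P != 0 by rewrite mulf_neq0.
  have fK0 : f i ^+ K != 0 by rewrite expf_neq0.
  rewrite -(mlead_deg (mulf_neq0 fK0 CP0)) (mleadM fK0 CP0) (mleadM Ci0 P0).
  rewrite 2!mdegD.
  have -> : mdeg (mlead (f i ^+ K)) = (mdeg (mlead (f i)) * K)%N
    by rewrite mleadX // mdegMn.
  have degP : mdeg (mlead P) = (n.-1 * (Q * K.-1))%N.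
    rewrite mlead_prod // mdeg_sum (eq_bigr (fun=> Q * K.-1)%N) => [|j _].
      by rewrite sum_nat_const cardC1 card_ord.
    by rewrite lead_G mdegMn mdeg1 mul1n.
  have degf := size_f i; rewrite -(mlead_deg fi0) in degf.
  have degC : (mdeg (mlead (C i)) < \sum_i msize (C i))%N.
    by rewrite (mlead_deg Ci0) (bigD1 i) //= leq_addr.
  rewrite degP; move: degC degf; rewrite /K.
  set S := (\sum_i _)%N; set b := mdeg _; set a := mdeg _ => Sb aQ.
  case: (n) npos => // n' _ /=.
  have : (a * (S + n'.+1).+2 <= Q.-1 * (S + n'.+1).+2)%N
    by rewrite leq_mul2r -ltnS prednK // aQ orbT.
  move: a b S (Q) aQ Qpos Sb => a b S q aQ qpos Sb; clear -aQ qpos Sb; nia.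
move/eqP: coef0; rewrite -lead_all mleadc_eq0 mulf_eq0 (negPf h'0) /=.
by apply/negP/prodf_neq0.
Qed.



Definition reduced_mnm (a : {ffun 'I_n -> 'I_Q}) : 'X_{1..n} :=
  [multinom val (a i) | i < n].

Definition reduced_poly (c : {ffun {ffun 'I_n -> 'I_Q} -> k}) : {mpoly k[n]} :=
  \sum_a c a *: 'X_[reduced_mnm a].

(** Division with remainder: as long as some exponent is at least Q, replacing X_i^Q by f_i lowers
    the total degree. So the quotient by the ideal has dimension at most Q^n. *)
Lemma frob_ideal_span h : exists c, frob_ideal (h - reduced_poly c).
Proof.
pose P h := exists c, frob_ideal (h - reduced_poly c).
have PI g' h' : frob_ideal (g' - h') -> P h' -> P g'.
  move=> Igh [c Ic]; exists c.
  by rewrite -(subrKA h'); exact: frob_idealD.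
have P0 : P 0.
  exists [ffun=> 0]; rewrite /reduced_poly big1 => [|a _].
    by rewrite subr0; exact: frob_ideal0.
  by rewrite ffunE scale0r.
have PD g' h' : P g' -> P h' -> P (g' + h').
  move=> [c Ic] [d Id]; exists [ffun a => c a + d a].
  rewrite [X in frob_ideal X](_ : _ = (g' - reduced_poly c) + (h' - reduced_poly d)).
    exact: frob_idealD.
  rewrite addrACA -opprD; congr (_ - _); rewrite -big_split; apply: eq_bigr => a _.
  by rewrite ffunE scalerDl.
have PZ b h' : P h' -> P (b *: h').
  move=> [c Ic]; exists [ffun a => b * c a].
  rewrite [X in frob_ideal X](_ : _ = b%:MP * (h' - reduced_poly c)).
    exact: frob_idealMr.
  rewrite mul_mpolyC scalerBr; congr (_ - _); rewrite scaler_sumr.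
  by apply: eq_bigr => a _; rewrite ffunE scalerA.
have PX N : forall m : 'X_{1..n}, (mdeg m < N)%N -> P 'X_[m].
  elim: N => // N IHN m; rewrite ltnS => mN.
  have [mQ|] := boolP [forall i, (m i < Q)%N].
    pose a : {ffun 'I_n -> 'I_Q} := [ffun i => Ordinal (forallP mQ i)].
    exists [ffun b => (b == a)%:R].
    rewrite /reduced_poly (bigD1 a) //= ffunE eqxx scale1r big1 => [|b /negPf ba].
      rewrite addr0 (_ : reduced_mnm a = m) ?subrr; first exact: frob_ideal0.
      by apply/mnmP => i; rewrite mnmE ffunE.
    by rewrite ffunE ba scale0r.
  case/forallPn => i; rewrite -leqNgt => Qi.
  have Um : (U_(i) *+ Q <= m)%MM.
    apply/mnm_lepP => j; rewrite mulmnE mnm1E.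
    by case: eqVneq => [<-|_]; rewrite ?mul1n.
  have Xm : 'X_[m] = 'X_[(m - U_(i) *+ Q)%MM] * ('X_i ^+ Q) :> {mpoly k[n]}.
    by rewrite mpolyXn -mpolyXD submK.
  apply: (PI _ ('X_[(m - U_(i) *+ Q)%MM] * f i)).
    by rewrite Xm -mulrBr; apply: frob_idealMr; exact: frob_ideal_gen.
  rewrite (mpolyE (f i)) mulr_sumr.
  rewrite big_seq; elim/big_ind: _ => // m' m'f.
  rewrite -scalerAr -mpolyXD; apply/PZ/IHN/(leq_trans _ mN).
  have := congr1 mdeg (submK Um); rewrite !mdegD mdegMn mdeg1 mul1n => <-.
  by rewrite ltn_add2l (leq_trans _ (size_f i)) // msize_mdeg_lt.
rewrite (mpolyE h); rewrite -/(P _); elim/big_ind: _ => // m _.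
exact/PZ/(PX (mdeg m).+1).
Qed.

(* If N is minimal with [g ^+ N] in the ideal, then 1, ..., g^(N-1) are linearly
   independent modulo the ideal: multiply a relation by a power of g to isolate
   its lowest term. *)
Lemma frob_ideal_nilp g N : frob_ideal (g ^+ N) -> frob_ideal (g ^+ (Q ^ n)).
Proof.
move=> gN.
have exN : exists N, `[< frob_ideal (g ^+ N) >] by exists N; apply/asboolP.
case: (ex_minnP exN) => {gN exN}N /asboolP gN minN.
have powI M : (N <= M)%N -> frob_ideal (g ^+ M).
  by move=> NM; rewrite -(subnK NM) exprD; exact: frob_idealMr.
apply: (powI _); rewrite leqNgt; apply/negP => ltN.
have /choice [c cP] : forall j : 'I_N, exists c, frob_ideal (g ^+ j - reduced_poly c).
  by move=> j; exact: frob_ideal_span.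
(* There are N > Q^n powers of g but only Q^n reduced monomials, so the rows are dependent. *)
pose M := \matrix_(j < N, a < #|{ffun 'I_n -> 'I_Q}|) c j (enum_val a).
have : kermx M != 0.
  rewrite kermx_eq0 /row_free neq_ltn (leq_ltn_trans (rank_leq_col M)) //.
  by rewrite card_ffun !card_ord.
case/rowV0Pn => v /sub_kermxP vM v0.
have [j0 vj0] : exists j, v 0 j != 0 by apply/rV0Pn.
pose j1 := [arg min_(j < j0 | (v 0 j != 0)%R) (j : nat)]%N.
have [vj1 j1min] : v 0 j1 != 0 /\ forall j : 'I_N, v 0 j != 0 -> (j1 <= j)%N.
  by rewrite /j1; case: arg_minnP.
have Isum : frob_ideal (\sum_j v 0 j *: g ^+ j).
  have -> : \sum_j v 0 j *: g ^+ j
          = \sum_j (v 0 j)%:MP * (g ^+ j - reduced_poly (c j)).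
    under [RHS]eq_bigr do rewrite mul_mpolyC scalerBr.
    rewrite [RHS]sumrB [X in _ - X](_ : _ = 0) ?subr0 //.
    under eq_bigr do rewrite scaler_sumr.
    rewrite exchange_big big1 //= => a _.
    under eq_bigr do rewrite scalerA.
    rewrite -scaler_suml [X in X *: _](_ : _ = 0) ?scale0r //.
    have := congr1 (fun w : 'rV_ _ => w 0 (enum_rank a)) vM; rewrite !mxE.
    apply: etrans.
    by apply: eq_bigr => j _; rewrite mxE enum_rankK.
  elim/big_ind: _ => [|? ?|j _]; [exact: frob_ideal0|exact: frob_idealD|].
  exact: frob_idealMr.
have : frob_ideal (g ^+ N.-1).
  have N1 : (j1 + (N.-1 - j1) = N.-1)%N by have := ltn_ord j1; lia.
  have : frob_ideal ((v 0 j1)^-1%:MP * (g ^+ (N.-1 - j1) * \sum_j v 0 j *: g ^+ j)).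
    by do 2!apply: frob_idealMr.
  rewrite (bigD1 j1) //= mulrDr mulrDr -scalerAr mul_mpolyC scalerA mulVf // scale1r.
  rewrite -exprD addnC N1 => Ig.
  rewrite -[X in frob_ideal X](addrK ((v 0 j1)^-1%:MP * (g ^+ (N.-1 - j1) *
    \sum_(j | j != j1) v 0 j *: g ^+ j))).
  apply: frob_idealB => //; apply: frob_idealMr; rewrite mulr_sumr.
  elim/big_ind: _ => [|? ?|j jj1]; [exact: frob_ideal0|exact: frob_idealD|].
  have [->|vj] := eqVneq (v 0 j) 0.
    by rewrite scale0r mulr0; exact: frob_ideal0.
  rewrite -mul_mpolyC mulrCA; apply: frob_idealMr; rewrite -exprD; apply: powI.
  have := j1min _ vj; have : (j : nat) != j1 by []; lia.
move/asboolP/minN; have := ltn_ord j1; lia.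
Qed.

End FrobeniusIdeal.

(** * Finite residue fields of prime ideals *)

Section ResidueField.
Local Open Scope quotient_scope.
Variables (R : comNzRingType) (I : prime_idealr R) (X : finType) (s : X -> R).
Hypothesis s_surj : forall x, exists y, x - s y \in (I : {pred R}).

(** The dummy binding makes the type remember [s_surj], on which its finiteness rests. *)
Definition residue_field := let _ := s_surj in {ideal_quot I}.

HB.instance Definition _ := GRing.ComNzRing.on residue_field.

Fact residue_repr_key (x : residue_field) : exists y,
  s y == generic_quotient.repr x %[mod {ideal_quot I}].
Proof.
have [y] := s_surj (generic_quotient.repr x).
by exists y; rewrite eq_sym -Quotient.idealrBE.
Qed.

Lemma residue_enum :
  cancel (fun x : residue_field => xchoose (residue_repr_key x))
         (fun y => \pi_({ideal_quot I}) (s y) : residue_field).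
Proof.
by move=> x; have /eqP -> := xchooseP (residue_repr_key x); rewrite reprK.
Qed.

HB.instance Definition _ : isCountable residue_field := CanIsCountable residue_enum.
HB.instance Definition _ : isFinite residue_field := CanIsFinite residue_enum.

Definition residue_inv (x : residue_field) : residue_field :=
  odflt 0 [pick y : residue_field | y * x == 1].

(** In a finite domain, multiplication by a nonzero x is injective, hence hits 1. *)
Lemma residue_mulVf (x : residue_field) : x != 0 -> residue_inv x * x = 1.
Proof.
move=> x0; rewrite /residue_inv; case: pickP => [y /eqP //|noinv].
have inj : injective (fun y : residue_field => y * x).
  move=> y z /eqP; rewrite -subr_eq0 -mulrBl => /eqP /Quotient.rquot_IdomainAxiom.
  by rewrite (negPf x0) orbF subr_eq0 => /eqP.
by have := noinv (invF inj 1); rewrite (f_invF inj) eqxx.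
Qed.

Lemma residue_inv0 : residue_inv 0 = 0.
Proof.
rewrite /residue_inv; case: pickP => [y|//].
by rewrite mulr0 eq_sym oner_eq0.
Qed.

HB.instance Definition _ :=
  GRing.ComNzRing_isField.Build residue_field residue_mulVf residue_inv0.

Definition residue_class (x : R) : residue_field := \pi_({ideal_quot I}) x.

Lemma residue_class_zmod : zmod_morphism residue_class.
Proof. by move=> x y; rewrite /residue_class; exact: rmorphB. Qed.
Lemma residue_class_monoid : monoid_morphism residue_class.
Proof.
split=> [|x y]; rewrite /residue_class; [exact: rmorph1|exact: rmorphM].
Qed.
HB.instance Definition _ := GRing.isZmodMorphism.Build R residue_field
  residue_class residue_class_zmod.
HB.instance Definition _ := GRing.isMonoidMorphism.Build R residue_field
  residue_class residue_class_monoid.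

Lemma residue_class_eq0 x : (residue_class x == 0) = (x \in (I : {pred R})).
Proof. by rewrite -[x in RHS]subr0 Quotient.idealrBE pi_zeror. Qed.

End ResidueField.

Lemma prime_ideal_residue (R : comNzRingType) (J : R -> Prop) (X : finType)
    (s : X -> R) :
  J 0 -> ~ J 1 -> (forall a x y, J x -> J y -> J (a * x + y)) ->
  (forall x y, J (x * y) -> J x \/ J y) ->
  (forall x, exists y, J (x - s y)) ->
  exists (L : finFieldType) (e : {rmorphism R -> L}), forall x, e x = 0 <-> J x.
Proof.
move=> J0 J1 JM Jprime Jsurj.
pose S : R -> bool := fun x => `[< J x >].
have SP x : reflect (J x) (x \in (S : {pred R})) by exact: asboolP.
have Sid : idealr_closed (S : {pred R}).
  split; [exact/SP|exact/SP|].
  by move=> a x y /SP Jx /SP Jy; apply/SP/JM.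
have Spr : prime_idealr_closed (S : {pred R}).
  by move=> x y /SP /Jprime [] Jx; apply/orP; [left|right]; apply/SP.
pose I : prime_idealr R :=
  HB.pack S (isIdealr.Build R S Sid) (isPrimeIdealrClosed.Build R S Spr).
have surj x : exists y, x - s y \in (I : {pred R}).
  by have [y Jy] := Jsurj x; exists y; exact/SP.
exists (residue_field surj : finFieldType), (residue_class surj) => x.
split=> [/eqP|/SP]; first by rewrite residue_class_eq0 => /SP.
by rewrite -(residue_class_eq0 surj) => /eqP.
Qed.

(** * Quasi-fixed points of a polynomial map over F_p *)

Section QuasiFixedPoint.
Variables (p n : nat) (f : 'I_n -> {mpoly 'F_p[n]}).
Hypothesis p_pr : prime p.
Local Notation R := {mpoly 'F_p[n]}.
Local Notation phi := (mmap (@mpolyC n 'F_p) f).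

Let pcharR : p \in [pchar R].
Proof. exact/(rmorph_pchar (@mpolyC n 'F_p))/pchar_Fp. Qed.

Lemma Fp_expX m (c : 'F_p) : c ^+ (p ^ m) = c.
Proof.
elim: m => [|m IHm]; first by rewrite expn0 expr1.
by rewrite expnSr exprM IHm -[RHS]expf_card card_Fp.
Qed.

(** The power p^m is additive and fixes the coefficients, which lie in F_p. So it is a ring
    endomorphism, like [phi], and the two need only be compared on the variables, where the
    difference is a generator. *)
Lemma frob_ideal_phi m (h : R) : frob_ideal (p ^ m) f (h ^+ (p ^ m) - phi h).
Proof.
have pn : [pchar R].-nat (p ^ m)%N.
  by rewrite pnatX (eq_pnat _ (pcharf_eq pcharR)) pnat_id.
have phiX mm : frob_ideal (p ^ m) f ('X_[mm] ^+ (p ^ m) - phi 'X_[mm]).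
  rewrite mmapX mpolyXE_id -prodrXl /mmap1.
  under eq_bigr do rewrite exprAC.
  apply: (big_ind2 (fun x y => frob_ideal (p ^ m) f (x - y))) => [|x1 x2 y1 y2 I1 I2|i _].
  - by rewrite subrr; exact: frob_ideal0.
  - have -> : x1 * y1 - x2 * y2 = y1 * (x1 - x2) + x2 * (y1 - y2) by ring.
    by apply: frob_idealD; exact: frob_idealMr.
  - rewrite subrXX mulrC; apply: frob_idealMr; exact: frob_ideal_gen.
rewrite (mpolyE h) rmorph_sum /=.
elim/big_ind2: _ => [|x1 x2 y1 y2 I1 I2|mm _].
- by rewrite expr0n expn_eq0 (gtn_eqF (prime_gt0 p_pr)) subr0; exact: frob_ideal0.
- by rewrite exprDn_pchar // opprD addrACA; exact: frob_idealD.
- rewrite mmapZ exprZn Fp_expX -mul_mpolyC -mulrBr; exact: frob_idealMr.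
Qed.

Lemma frob_ideal_phi_iter m (g : R) j :
  frob_ideal (p ^ m) f (g ^+ ((p ^ m) ^ j) - iter j phi g).
Proof.
elim: j g => [|j IHj] g; first by rewrite expn0 expr1 subrr; exact: frob_ideal0.
rewrite iterSr expnS exprM.
rewrite -(subrKA (phi g ^+ ((p ^ m) ^ j))); apply: frob_idealD; last exact: IHj.
by rewrite subrXX mulrC; apply: frob_idealMr; exact: frob_ideal_phi.
Qed.

(** If a power of g lay in I, [frob_ideal_nilp] would put g^(Q^n) in I, hence also [iter n phi g],
    which is congruent to it; as its degree is below Q, this contradicts [frob_ideal_reduced]. An
    ideal maximal among those containing I and avoiding the powers of g is then prime, and L is its
    residue field. *)
Theorem quasi_fixed_point (g : R) :
  iter n phi g != 0 ->
  exists (L : finFieldType) (e : {rmorphism R -> L}) (m : nat),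
    (forall i, e (f i) = e 'X_i ^+ (p ^ m)) /\ e g != 0.
Proof.
move=> phig0.
(* Large enough for Q = p^m to bound the degrees of the f_i and of [iter n phi g]. *)
pose m := (\sum_i msize (f i) + msize (iter n phi g))%N.
pose Q := (p ^ m)%N.
have mQ : (m <= Q)%N by rewrite ltnW // ltn_expl // prime_gt1.
have size_f i : (msize (f i) <= Q)%N.
  by apply: leq_trans mQ; rewrite /m (bigD1 i) //= -addnA leq_addr.
pose I := frob_ideal Q f.
have Ig N : ~ I (g ^+ N).
  move=> /(frob_ideal_nilp size_f) IgQ.
  have : I (iter n phi g).
    have -> : iter n phi g = g ^+ (Q ^ n) - (g ^+ (Q ^ n) - iter n phi g)
      by rewrite opprB addrC subrK.
    by apply: frob_idealB => //; exact: frob_ideal_phi_iter.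
  apply: (frob_ideal_reduced size_f) => // i.
  apply: leq_trans mQ; apply: leq_trans (leq_addl _ _).
  rewrite -(mlead_deg phig0) ltnS mdegE (bigD1 i) //= leq_addr //.
(* An ideal containing I is determined by the reduced polynomials in it. There are finitely many of
   these, so maximising their number [sz] takes the place of Zorn's lemma. *)
pose good (J : R -> Prop) := [/\ forall h, I h -> J h,
   forall a x y, J x -> J y -> J (a * x + y) & forall N, ~ J (g ^+ N)].
pose V := {ffun {ffun 'I_n -> 'I_Q} -> 'F_p}.
pose sz (J : R -> Prop) := #|[set c : V | `[< J (reduced_poly c) >]]|.
have exJ : exists N, `[< exists2 J, good J & sz J = N >].
  exists (sz I); apply/asboolP; exists I => //; split => // a x y Ix Iy.
  by apply: frob_idealD => //; exact: frob_idealMr.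
have bnd N : `[< exists2 J, good J & sz J = N >] -> (N <= #|V|)%N.
  by move/asboolP => [J _ <-]; exact: max_card.
case: (ex_maxnP exJ bnd) => _ /asboolP [J [IJ JM Jg] <-] Jmax {exJ bnd}.
have J0 : J 0 by apply/IJ/frob_ideal0.
have J1 : ~ J 1 by exact: (Jg 0%N).
have JMr a x : J x -> J (a * x) by move=> Jx; rewrite -[_ * _]addr0; exact: JM.
have JD x y : J x -> J y -> J (x + y).
  by move=> Jx Jy; rewrite -[x]mul1r; exact: JM.
have JB x y : J x -> J y -> J (x - y).
  by move=> Jx Jy; apply: JD => //; rewrite -mulN1r; exact: JMr.
(* By maximality, the ideal generated by J and u meets the powers of g. *)
have big u : ~ J u -> exists a b N, J b /\ g ^+ N = b + a * u.
  move=> Ju; apply: contrapT => none.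
  pose J' h := exists a b, J b /\ h = b + a * u.
  have JJ' h : J h -> J' h by move=> Jh; exists 0, h; rewrite mul0r addr0.
  have J'M a x y : J' x -> J' y -> J' (a * x + y).
    move=> [a1 [b1 [Jb1 ->]]] [a2 [b2 [Jb2 ->]]].
    exists (a * a1 + a2), (a * b1 + b2); split; first exact: JM.
    by ring.
  have goodJ' : good J'.
    split=> // [h /IJ /JJ' //|N [a [b [Jb gN]]]].
    by apply: none; exists a, b, N.
  have : (sz J' <= sz J)%N by apply: Jmax; apply/asboolP; exists J'.
  apply/negP; rewrite -ltnNge; apply/proper_card/properP; split.
    by apply/subsetP => c; rewrite !inE => /asboolP /JJ' ?; apply/asboolP.
  have [c Ic] := frob_ideal_span size_f u.
  exists c; rewrite !inE.
    apply/asboolP; exists 1, (- (u - reduced_poly c)); split.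
      by rewrite -[- _]add0r; apply: JB => //; exact: IJ.
    by ring.
  apply/asboolP => Jc; apply: Ju.
  by rewrite -(subrK (reduced_poly c) u); apply: JD => //; exact: IJ.
have Jpr x y : J (x * y) -> J x \/ J y.
  move=> Jxy; apply: contrapT => /not_orP [/big [a [b [N [Jb gN]]]]].
  move=> /big [a' [b' [N' [Jb' gN']]]].
  apply: (Jg (N + N')%N); rewrite exprD gN gN'.
  have -> : (b + a * x) * (b' + a' * y) =
    (b' + a' * y) * b + (a * x * b' + (a * a') * (x * y)) by ring.
  by apply: JM => //; apply: JD; exact: JMr.
have Jspan (h : R) : exists c : V, J (h - reduced_poly c).
  by have [c Ic] := frob_ideal_span size_f h; exists c; exact: IJ.
have [L [e eP]] := prime_ideal_residue J0 J1 JM Jpr Jspan.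
exists L, e, m; split=> [i|].
  apply/esym/eqP; rewrite -rmorphXn -subr_eq0 -rmorphB; apply/eqP/eP/IJ.
  exact: frob_ideal_gen.
by apply/eqP => /eP; exact: (Jg 1%N).
Qed.

End QuasiFixedPoint.

(** * Presented groups and first homology *)

Section PresentedLift.
Variables (X : choiceType) (R : word X -> word X -> Prop) (P : groupType).
Variable h : X -> P.
Local Open Scope group_scope.

Definition letter_val (l : X * bool) : P := if l.2 then h l.1 else (h l.1)^-1.
Definition word_val (u : word X) : P := \prod_(l <- u) letter_val l.

Lemma word_val_cat u v : word_val (u ++ v) = word_val u * word_val v.
Proof. by rewrite /word_val big_cat. Qed.

Lemma word_val_cong u v : (forall u v, R u v -> word_val u = word_val v) ->
  pres_cong R u v -> word_val u = word_val v.
Proof.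
move=> hR; elim=> {u v} [u v /hR //|x b|//|//|v u w _ -> //|u u' v v' _ IHu _ IHv].
  rewrite /word_val !big_cons !big_nil mulg1.
  by case: b; rewrite /letter_val /= ?mulgV ?mulVg.
by rewrite !word_val_cat IHu IHv.
Qed.

Lemma presented_lift : (forall u v, R u v -> word_val u = word_val v) ->
  exists f : {multiplicative presented R -> P},
    forall u, f (pres_class R u) = word_val u.
Proof.
move=> hR; pose f (x : presented R) := word_val (generic_quotient.repr x).
have fE u : f (pres_class R u) = word_val u.
  by apply/(word_val_cong hR)/pres_classP; exact: pres_class_repr.
have fM : {morph f : x y / x * y}.
  by move=> x y; rewrite -[x * y]/(pres_mul x y) fE word_val_cat.
exists (HB.pack_for {multiplicative presented R -> P} f (isMultiplicative.Build _ _ f fM)).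
by move=> u; rewrite -fE.
Qed.

End PresentedLift.

(** * Classes in first homology detected by additive functions *)

Section FirstHomology.
Import finmap monalg.
Variables (G : groupType) (k : fieldType) (S : nzRingType) (J : Type).
Variables (iota : {additive k -> S}) (mu : J -> G -> S).
Hypothesis muM : forall j, {morph mu j : x y / (x * y)%g >-> x + y}.

Let one_chain (h : G) : bar_chain G k 1 := << [ffun=> h] >>.
Let ev j := monalg.mmap iota (fun g : {ffun 'I_1 -> G} => mu j (g ord0)).

Let scale_basis (K : choiceType) (c : k) (x : K) :
  c *: << x >> = << c *g x >> :> {malg k[K]}.
Proof. by apply/malgP => y; rewrite mcoeffZ !mcoeffU mulrnAr mulr1. Qed.

Let ev_boundary j (c : bar_chain G k 2) : ev j (bar_diff c) = 0.
Proof.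
rewrite /ev /bar_diff raddf_sum big1 //= => g _.
rewrite raddf_sum !big_ord_recl big_ord0 /= !scale_basis !monalg.mmapU.
rewrite !ffunE /= muM /bump /= expr0 expr1 sqrrN expr1n mulN1r mul1r raddfN.
by rewrite mulNr mulrDr opprD addr0 [- _ - _ + _]addrAC addNr add0r subrr.
Qed.

(** The boundary of [g|h] is [h] - [gh] + [g], so additive functions on G, extended linearly through
    [iota], vanish on boundaries. Every 1-chain [h] is a cycle because its two faces coincide. *)
Lemma homology1_dim_ge m (h : 'I_m -> G) :
  (forall a : 'I_m -> k,
     (forall j, \sum_i iota (a i) * mu j (h i) = 0) -> forall i, a i = 0) ->
  homology_dim_ge G k 1 m.
Proof.
move=> indep; exists (fun i => one_chain (h i)); split=> [i|a [b bE]].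
  rewrite /bar_cycle /bar_diff /one_chain msuppU oner_eq0 big_seq_fset1.
  rewrite !big_ord_recl big_ord0 /= addr0 expr0 mul1r mcoeffUU mulr1 /bump /= expr1.
  rewrite scale1r scaleN1r; apply/eqP; rewrite subr_eq0; apply/eqP; congr << _ >>.
  by apply/ffunP => -[].
apply: indep => j; apply: etrans (ev_boundary j b); rewrite bE /ev raddf_sum.
by apply: eq_bigr => i _; rewrite /= scale_basis monalg.mmapU ffunE.
Qed.

End FirstHomology.

(** * Matrices of size two over a commutative ring *)

Lemma I2_ind (P : 'I_2 -> 'I_2 -> Prop) :
  P 0 0 -> P 0 1 -> P 1 0 -> P 1 1 -> forall i j, P i j.
Proof.
have I2 (i : 'I_2) : i = 0 \/ i = 1.
  by case: i => [[|[|//]] hi]; [left|right]; exact: val_inj.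
by move=> P00 P01 P10 P11 i j; case: (I2 i) (I2 j) => -> [] ->.
Qed.

Section Matrix2.
Variable S : comNzRingType.
Implicit Types A B : 'M[S]_2.

Lemma mx2P A B : A 0 0 = B 0 0 -> A 0 1 = B 0 1 -> A 1 0 = B 1 0 ->
  A 1 1 = B 1 1 -> A = B.
Proof. by move=> *; apply/matrixP; exact: I2_ind. Qed.

Lemma mul2E A B i j : (A * B) i j = A i 0 * B 0 j + A i 1 * B 1 j.
Proof.
rewrite -mulmxE mxE !big_ord_recl big_ord0 addr0.
by rewrite (_ : lift ord0 ord0 = 1) //; exact: val_inj.
Qed.

Lemma tr2E A : \tr A = A 0 0 + A 1 1.
Proof.
rewrite /mxtrace !big_ord_recl big_ord0 addr0.
by rewrite (_ : lift ord0 ord0 = 1) //; exact: val_inj.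
Qed.

Lemma cofactor2E A (i j : 'I_2) :
  cofactor A i j = (-1) ^+ (i + j) * A (lift i 0) (lift j 0).
Proof. by rewrite /cofactor det_mx11 !mxE. Qed.

Lemma det2E A : \det A = A 0 0 * A 1 1 - A 0 1 * A 1 0.
Proof.
rewrite (expand_det_row _ 0) !big_ord_recl big_ord0 addr0 !cofactor2E /=.
have -> : lift (0 : 'I_2) 0 = 1 by exact: val_inj.
have -> : lift (1 : 'I_2) 0 = 0 by exact: val_inj.
by rewrite expr0 mul1r expr1 mulN1r mulrN.
Qed.

Lemma adj2E A : \adj A = (\tr A)%:M - A.
Proof.
have l0 : lift (0 : 'I_2) (0 : 'I_1) = 1 by exact: val_inj.
have l1 : lift (1 : 'I_2) (0 : 'I_1) = 0 by exact: val_inj.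
by apply: mx2P; rewrite !mxE cofactor2E tr2E ?l0 ?l1 /=; ring.
Qed.

Definition mx2E := (mul2E, tr2E, det2E, adj2E, mxE).

Lemma adj2M A B : \adj (A * B) = \adj B * \adj A.
Proof. by apply: mx2P; rewrite !mx2E /=; ring. Qed.

Lemma adj2K A : \adj (\adj A) = A.
Proof. by apply: mx2P; rewrite !mx2E /=; ring. Qed.

Lemma adj21 : \adj (1 : 'M[S]_2) = 1.
Proof. by apply: mx2P; rewrite !mx2E /=; ring. Qed.

Lemma det2_adj A : \det (\adj A) = \det A.
Proof. by rewrite !mx2E /=; ring. Qed.

(** Relates the additive commutator to the group commutator: when A and B are invertible, the left
    side vanishes exactly when the latter has trace 2. *)
Lemma det2_comm A B :
  \det (A * B - B * A) = 2 * (\det A * \det B) - \tr (A * B * \adj A * \adj B).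
Proof. by rewrite !mx2E /=; ring. Qed.

End Matrix2.

(** * Dual numbers *)

(** The pair (a, b) is a + eps b; a name of its own keeps this product apart from the componentwise
    one. *)
Definition dual (R : Type) : Type := R * R.

Section Dual.
Variable R : comNzRingType.
HB.instance Definition _ := GRing.Zmodule.copy (dual R) (R * R)%type.
Implicit Types x y : dual R.

Definition dual_one : dual R := (1, 0).
Definition dual_mul x y : dual R := (x.1 * y.1, x.1 * y.2 + x.2 * y.1).

Fact dual_mulA : associative dual_mul.
Proof. by case=> a b [c d] [e f]; congr pair => /=; ring. Qed.
Fact dual_mulC : commutative dual_mul.
Proof. by case=> a b [c d]; congr pair => /=; ring. Qed.
Fact dual_mul1 : left_id dual_one dual_mul.
Proof. by case=> a b; congr pair => /=; ring. Qed.
Fact dual_mulDl : left_distributive dual_mul +%R.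
Proof. by case=> a b [c d] [e f]; congr pair => /=; ring. Qed.
Fact dual_one_neq0 : dual_one != 0.
Proof. by apply/eqP => -[/eqP]; rewrite oner_eq0. Qed.

HB.instance Definition _ := GRing.Zmodule_isComNzRing.Build (dual R)
  dual_mulA dual_mulC dual_mul1 dual_mulDl dual_one_neq0.

Lemma dualM x y : x * y = (x.1 * y.1, x.1 * y.2 + x.2 * y.1) :> dual R.
Proof. by []. Qed.
Lemma dualD x y : x + y = (x.1 + y.1, x.2 + y.2) :> dual R.
Proof. by []. Qed.
Lemma dualN x : - x = (- x.1, - x.2) :> dual R.
Proof. by []. Qed.

Definition dual_re (x : dual R) : R := x.1.
Definition dual_cst (a : R) : dual R := (a, 0).

Fact dual_re_zmod : zmod_morphism dual_re.
Proof. by []. Qed.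
Fact dual_re_monoid : monoid_morphism dual_re.
Proof. by []. Qed.
HB.instance Definition _ := GRing.isZmodMorphism.Build (dual R) R dual_re dual_re_zmod.
HB.instance Definition _ := GRing.isMonoidMorphism.Build (dual R) R dual_re dual_re_monoid.

Fact dual_cst_zmod : zmod_morphism dual_cst.
Proof. by move=> a b; congr pair; rewrite /= subrr. Qed.
Fact dual_cst_monoid : monoid_morphism dual_cst.
Proof. by split=> // a b; congr pair => /=; ring. Qed.
HB.instance Definition _ := GRing.isZmodMorphism.Build R (dual R) dual_cst dual_cst_zmod.
HB.instance Definition _ :=
  GRing.isMonoidMorphism.Build R (dual R) dual_cst dual_cst_monoid.

End Dual.

Section DualMap.
Variables (R R' : comNzRingType) (f : {rmorphism R -> R'}).

Definition dual_map (x : dual R) : dual R' := (f x.1, f x.2).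

Fact dual_map_zmod : zmod_morphism dual_map.
Proof. by move=> x y; congr pair; rewrite /= rmorphB. Qed.
Fact dual_map_monoid : monoid_morphism dual_map.
Proof.
split=> [|x y]; congr pair => /=; rewrite ?rmorph1 ?rmorph0 //.
  by rewrite rmorphM.
by rewrite rmorphD !rmorphM.
Qed.
HB.instance Definition _ := GRing.isZmodMorphism.Build _ _ dual_map dual_map_zmod.
HB.instance Definition _ := GRing.isMonoidMorphism.Build _ _ dual_map dual_map_monoid.
End DualMap.

Section DualPoly.
Variable R : comNzRingType.

(* The substitution T |-> T + eps. *)
Definition dual_poly (f : {poly R}) : dual {poly R} := (f, f^`()).

Fact dual_poly_zmod : zmod_morphism dual_poly.
Proof. by move=> x y; congr pair; rewrite /= derivB. Qed.
Fact dual_poly_monoid : monoid_morphism dual_poly.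
Proof.
split=> [|x y]; congr pair => /=; first by rewrite -polyC1 derivC.
by rewrite derivM addrC.
Qed.
HB.instance Definition _ := GRing.isZmodMorphism.Build _ _ dual_poly dual_poly_zmod.
HB.instance Definition _ := GRing.isMonoidMorphism.Build _ _ dual_poly dual_poly_monoid.
End DualPoly.

(** * Discriminant and derivative of the trace invariant *)

Section Discriminant.
Variable R : comNzRingType.

Definition disc (t d : dual R) : R := t.1 ^+ 2 - 4 * d.1.

(* The derivative of t ^ 2 / d is [t.1 * ddisc t d / d.1 ^ 2]. *)
Definition ddisc (t d : dual R) : R := 2 * t.2 * d.1 - t.1 * d.2.

(** Three conditions in one polynomial of the entries: the real part has nonzero discriminant,
    [ddisc] does not vanish, and the determinant is a unit. *)
Definition discM (A : 'M[dual R]_2) : R :=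
  disc (\tr A) (\det A) * ddisc (\tr A) (\det A) * (\det A).1.

(** Cyclic reduction of a word multiplies the trace by some s and the determinant by s^2; this lemma
    and [ddiscZ] say that only the real part of s then matters. *)
Lemma discZ s t d : disc (s * t) (s ^+ 2 * d) = s.1 ^+ 2 * disc t d.
Proof. by rewrite /disc expr2 !dualM /=; ring. Qed.

Lemma ddiscZ s t d : ddisc (s * t) (s ^+ 2 * d) = s.1 ^+ 3 * ddisc t d.
Proof. by rewrite /ddisc expr2 !dualM /=; ring. Qed.

End Discriminant.

Lemma discM_map (R R' : comNzRingType) (f : {rmorphism R -> R'}) A :
  discM (map_mx (dual_map f) A) = f (discM A).
Proof.
rewrite /discM trace_map_mx det_map_mx /disc /ddisc /=.
by rewrite !(rmorphM, rmorphB, rmorphXn, rmorph_nat).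
Qed.

(** * Words evaluated at matrices of size two *)

Definition word_subst (X Y : Type) (Theta : X -> word Y) (w : word X) : word Y :=
  flatten [seq if l.2 then Theta l.1 else word_inv (Theta l.1) | l <- w].

Section WordMx.
Variables (X : Type) (S : comNzRingType).
Implicit Types (A : X -> 'M[S]_2) (w u : word X).

(* The inverse of a letter is evaluated at the adjugate, so that evaluation is
   polynomial; it is multiplicative up to scalars only. *)
Definition letter_mx A (l : X * bool) : 'M[S]_2 :=
  if l.2 then A l.1 else \adj (A l.1).

Definition word_mx A w : 'M[S]_2 := \prod_(l <- w) letter_mx A l.

Lemma word_mx_cat A u w : word_mx A (u ++ w) = word_mx A u * word_mx A w.
Proof. by rewrite /word_mx big_cat. Qed.

Lemma word_mx_cons A l w : word_mx A (l :: w) = letter_mx A l * word_mx A w.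
Proof. by rewrite /word_mx big_cons. Qed.

Lemma letter_mxN A x b : letter_mx A (x, ~~ b) = \adj (letter_mx A (x, b)).
Proof. by case: b; rewrite /letter_mx //= adj2K. Qed.

Lemma word_mx_inv A w : word_mx A (word_inv w) = \adj (word_mx A w).
Proof.
elim: w => [|[x b] w IHw]; first by rewrite /word_mx !big_nil adj21.
rewrite /word_inv /= rev_cons -cats1 word_mx_cat -/(word_inv w) IHw.
by rewrite {2}/word_mx big_seq1 letter_mxN word_mx_cons adj2M.
Qed.

Lemma det_letter_mx A l : \det (letter_mx A l) = \det (A l.1).
Proof. by rewrite /letter_mx; case: l.2 => //; rewrite det2_adj. Qed.

Lemma det_word_mx A w : \det (word_mx A w) = \prod_(l <- w) \det (A l.1).
Proof.
elim: w => [|l w IHw]; first by rewrite /word_mx !big_nil det1.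
by rewrite word_mx_cons detM IHw big_cons det_letter_mx.
Qed.

Lemma word_mx_cancel A x b w :
  word_mx A ((x, b) :: (x, ~~ b) :: w) = \det (A x) *: word_mx A w.
Proof.
rewrite !word_mx_cons mulrA letter_mxN -!mulmxE mul_mx_adj det_letter_mx.
exact: mul_scalar_mx.
Qed.

Lemma tr_word_mx_rot A n w : \tr (word_mx A (rot n w)) = \tr (word_mx A w).
Proof.
rewrite /rot word_mx_cat -mulmxE mxtrace_mulC mulmxE -word_mx_cat.
by rewrite cat_take_drop.
Qed.

Lemma word_mx_letter A x : word_mx A [:: (x, true)] = A x.
Proof. by rewrite /word_mx big_seq1. Qed.

Lemma word_mx_pair A x y : word_mx A [:: (x, true); (y, true)] = A x * A y.
Proof. by rewrite /word_mx !big_cons big_nil mulr1. Qed.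

Lemma word_mx_commutator A x y :
  word_mx A [:: (x, true); (y, true); (x, false); (y, false)] =
  A x * A y * \adj (A x) * \adj (A y).
Proof. by rewrite /word_mx !big_cons big_nil mulr1 !mulrA. Qed.

Lemma eq_word_mx A A' w : A =1 A' -> word_mx A w = word_mx A' w.
Proof.
by move=> eA; apply: eq_bigr => l _; rewrite /letter_mx !eA.
Qed.

End WordMx.

Lemma word_mx_map (X : Type) (S S' : comNzRingType) (f : {rmorphism S -> S'})
    (A : X -> 'M[S]_2) w :
  map_mx f (word_mx A w) = word_mx (fun x => map_mx f (A x)) w.
Proof.
elim: w => [|l w IHw]; first by rewrite /word_mx !big_nil map_mx1.
rewrite !word_mx_cons -!mulmxE map_mxM IHw /letter_mx; congr (_ *m _).
by case: l.2; rewrite // map_mx_adj.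
Qed.

Lemma word_mx_subst (X Y : Type) (S : comNzRingType) (Theta : X -> word Y)
    (A : Y -> 'M[S]_2) w :
  word_mx A (word_subst Theta w) = word_mx (fun x => word_mx A (Theta x)) w.
Proof.
elim: w => [|l w IHw]; first by rewrite /word_mx !big_nil.
rewrite /word_subst /= word_mx_cat word_mx_cons -IHw; congr (_ * _).
by rewrite /letter_mx; case: l.2; rewrite ?word_mx_inv.
Qed.

Lemma multiplicative1 (G H : groupType) (f : {multiplicative G -> H}) :
  f 1%g = 1%g.
Proof. by apply: (mulgI (f 1%g)); rewrite -gmulfM !mulg1. Qed.

Lemma multiplicativeV (G H : groupType) (f : {multiplicative G -> H}) x :
  f x^-1%g = (f x)^-1%g.
Proof. by apply/esym/mulg1_eq; rewrite -gmulfM mulgV multiplicative1. Qed.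

Lemma pres_class_cat (X : choiceType) (R : word X -> word X -> Prop) u v :
  pres_class R (u ++ v) = (pres_class R u * pres_class R v)%g.
Proof. by rewrite -[RHS]/(pres_mul _ _) pres_mulE. Qed.

Lemma word_subst_class (X Y : choiceType) (RX : word X -> word X -> Prop)
    (RY : word Y -> word Y -> Prop)
    (theta : {multiplicative presented RX -> presented RY})
    (Theta : X -> word Y) :
  (forall x, pres_class RY (Theta x) = theta (pres_class RX [:: (x, true)])) ->
  forall w, pres_class RY (word_subst Theta w) = theta (pres_class RX w).
Proof.
move=> ThetaE.
have invE (Z : choiceType) RZ (u : word Z) :
    pres_class RZ (word_inv u) = (pres_class RZ u)^-1%g.
  apply/esym/mulg1_eq; rewrite -pres_class_cat; apply/pres_classP.
  exact: pres_cong_invr.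
elim=> [|[x b] w IHw]; first by rewrite -[RHS]/(theta 1%g) multiplicative1.
rewrite /word_subst /= pres_class_cat -/(word_subst _ _) IHw.
rewrite -[(x, b) :: w]cat1s pres_class_cat gmulfM.
congr (_ * _)%g; case: b => //=; rewrite invE ThetaE -multiplicativeV; congr (theta _).
by rewrite -invE.
Qed.

(** * Cyclically reduced words and a matrix specialisation *)

Definition letter_inv (X : Type) (l : X * bool) : X * bool := (l.1, ~~ l.2).

Section CyclicReduction.
Variable X : choiceType.
Implicit Types (w c : word X).

Definition no_cancel : rel (X * bool) := fun l l' => l' != letter_inv l.

Lemma not_path_adjacent (T : Type) (e : rel T) x s : ~~ path e x s ->
  exists s1 y z s2, x :: s = s1 ++ y :: z :: s2 /\ ~~ e y z.
Proof.
elim: s x => // y s IHs x /=; have [exy|exy _] := boolP (e x y) => /=.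
  by case/IHs => s1 [z [t [s2 [-> ezt]]]]; exists (x :: s1), z, t, s2.
by exists [::], x, y, s.
Qed.

Lemma not_cycle_rot w : ~~ path.cycle no_cancel w ->
  exists n x b u, rot n w = (x, b) :: (x, ~~ b) :: u.
Proof.
case: w => // l0 w /= /(@not_path_adjacent _ no_cancel) [s1 [[x b] [m [s2 [E]]]]].
rewrite negbK => /eqP Em; rewrite Em /letter_inv /= in E.
case/lastP: s2 E => [|s2 l]; rewrite -rcons_cons.
  (* Wrap-around case: the pair is the last letter followed by the first one. It is not a single
     letter followed by itself, since no letter is its own inverse. *)
  rewrite -cat_rcons cats1 => /rcons_inj [].
  case: s1 => [|l1 s1] E l0E.
    by case: E => El0 _; move: l0E; rewrite El0 => -[]; case: (b).
  exists (size (l1 :: s1)), x, b, s1; rewrite E -cats1 rot_size_cat /=.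
  by case: E => <- _; rewrite l0E.
rewrite -!rcons_cons -rcons_cat => /rcons_inj [-> _].
by exists (size s1), x, b, (s2 ++ s1); rewrite rot_size_cat.
Qed.

(** Rotation preserves trace and determinant. Cancelling x against x^-1 scales the value by det (A
    x), because the inverse letter is an adjugate; this enters the trace once and the determinant
    squared. The last clause serves to show that c is nonempty when w is nontrivial. *)
Lemma cyclic_reduction w :
  exists xs c, [/\ path.cycle no_cancel c, (size c <= size w)%N,
    forall (S : comNzRingType) (A : X -> 'M[S]_2),
      \tr (word_mx A w) = (\prod_(x <- xs) \det (A x)) * \tr (word_mx A c) /\
      \det (word_mx A w) = (\prod_(x <- xs) \det (A x)) ^+ 2 * \det (word_mx A c)
    & forall R, pres_cong R c [::] -> pres_cong R w [::]].
Proof.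
have [N] := ubnP (size w); elim: N w => // N IHN w wN.
have [cw|/not_cycle_rot [n [x [b [u rotE]]]]] := boolP (path.cycle no_cancel w).
  by exists [::], w; split=> // S A; rewrite big_nil expr1n !mul1r.
have szw : size w = (size u).+2 by rewrite -(size_rot n) rotE.
have /IHN [xs [c [cc sc cE cR]]] : (size u < N)%N by rewrite szw in wN; lia.
exists (x :: xs), c; split=> // [|S A|R /cR uR]; first by rewrite szw; lia.
  have [tE dE] := cE S A; rewrite big_cons -(tr_word_mx_rot A n) rotE word_mx_cancel.
  rewrite mxtraceZ tE mulrA; split=> //.
  have -> : \det (word_mx A w) = \det (word_mx A (rot n w)).
    by rewrite /rot -{1}[w](cat_take_drop n) !word_mx_cat !detM mulrC.
  by rewrite rotE word_mx_cancel detZ dE exprMn; ring.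
have {}uR : pres_cong R (rot n w) [::].
  rewrite rotE -[_ :: _]/([:: (x, b); (x, ~~ b)] ++ u).
  exact: (PresCat (PresCancel R x b) uR).
move: uR; rewrite /rot => /pres_classP uR; apply/pres_classP.
rewrite -[w in LHS](cat_take_drop n) pres_class_cat.
by rewrite pres_class_cat in uR; rewrite -(mulg1_eq uR) mulVg.
Qed.

End CyclicReduction.
Arguments no_cancel {X}.

Section Specialisation.
Variables (F : fieldType) (X : choiceType) (a : X * bool -> F).
Hypothesis a_inj : injective a.
Implicit Types (l : X * bool) (w : word X).

(* The product of the column (1, a l) and the row (- a l'^-1, 1). *)
Definition rank1_mx l l' : 'M[F]_2 :=
  \matrix_(i, j) ((if i == 0 then 1 else a l) *
                   (if j == 0 then - a (letter_inv l') else 1)).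

Lemma rank1_mxM l l' m m' :
  rank1_mx l l' * rank1_mx m m' = (a m - a (letter_inv l')) *: rank1_mx l m'.
Proof. by apply: mx2P; rewrite !mx2E /=; ring. Qed.

Lemma tr_rank1_mx l l' : \tr (rank1_mx l l') = a l - a (letter_inv l').
Proof. by rewrite !mx2E /=; ring. Qed.

(** Each junction of consecutive letters l, m contributes the factor a(m) - a(l^-1), nonzero because
    the letters do not cancel and a is injective. Taking the trace closes the cycle with one more
    such factor. *)
Lemma prod_rank1_mx l w : path no_cancel l w ->
  exists2 c, c != 0 &
    \prod_(m <- l :: w) rank1_mx m m = c *: rank1_mx l (last l w).
Proof.
elim: w l => [|m w IHw] l /=.
  by exists 1; rewrite ?oner_eq0 // big_seq1 scale1r.
case/andP=> lm /IHw [c c0 E]; exists (c * (a m - a (letter_inv l))).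
  by rewrite mulf_neq0 // subr_eq0 (inj_eq a_inj).
by rewrite big_cons E -scalerAr rank1_mxM scalerA.
Qed.

Lemma tr_prod_rank1_mx w : w != [::] -> path.cycle no_cancel w ->
  \tr (\prod_(m <- w) rank1_mx m m) != 0.
Proof.
case: w => // l w _; rewrite /= rcons_path => /andP [/prod_rank1_mx [c c0 ->] wl].
by rewrite linearZ /= tr_rank1_mx mulf_neq0 // subr_eq0 (inj_eq a_inj).
Qed.

(* As adj (rank1_mx l l) = - rank1_mx l^-1 l^-1, this is T P + adj P for
   P = rank1_mx (x, true) (x, true). *)
Definition special_mx (x : X) : 'M[{poly F}]_2 :=
  'X *: map_mx polyC (rank1_mx (x, true) (x, true))
  - map_mx polyC (rank1_mx (x, false) (x, false)).

(** Passing to the inverse letter swaps the two rank-one matrices in [special_mx], up to this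
    sign. *)
Definition letter_sign l : F := if l.2 then 1 else -1.

Lemma letter_sign_neq0 l : letter_sign l != 0.
Proof. by rewrite /letter_sign; case: l.2; rewrite ?oppr_eq0 oner_eq0. Qed.

Lemma letter_special_mxE l i j : letter_mx special_mx l i j =
  'X * (letter_sign l * rank1_mx l l i j)%:P
  - (letter_sign l * rank1_mx (letter_inv l) (letter_inv l) i j)%:P.
Proof.
have E (x : X) : special_mx x i j =
    'X * (rank1_mx (x, true) (x, true) i j)%:P
    - (rank1_mx (x, false) (x, false) i j)%:P.
  by rewrite !mxE.
case: l => x []; rewrite /letter_mx /letter_sign /letter_inv /=; first by rewrite E !mul1r.
move: i j {E}; apply: I2_ind; rewrite !mx2E /= /letter_inv /=;
rewrite ?(rmorphM, rmorphN, rmorph1) /=; ring.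
Qed.

Lemma det_special_mx x :
  \det (special_mx x) = ((a (x, true) - a (x, false)) ^+ 2) *: 'X.
Proof.
rewrite !mx2E /= /letter_inv /= -mul_polyC.
rewrite ?(rmorphM, rmorphN, rmorph1, rmorphB, rmorphXn) /=.
by ring.
Qed.

(** Letters are linear in T, so the coefficient of T^(size w) is the product of their linear
    coefficients. *)
Lemma word_special_mx w i j :
  (size (word_mx special_mx w i j) <= (size w).+1)%N /\
  (word_mx special_mx w i j)`_(size w) =
    \prod_(m <- w) letter_sign m * (\prod_(m <- w) rank1_mx m m) i j.
Proof.
elim: w i j => [|l w IHw] i j.
  have oneE (T : comNzRingType) : (1 : 'M[T]_2) i j = (i == j)%:R by rewrite mxE.
  rewrite /word_mx !big_nil mul1r !oneE.
  by case: (i == j); rewrite ?mulr1n ?mulr0n ?coef1 ?coef0 ?size_poly1 ?size_poly0.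
rewrite word_mx_cons big_cons !mul2E.
set W := word_mx special_mx w.
have sizeXW (b c : F) (k : 'I_2) : (size (('X * b%:P + c%:P) * W k j)%R <= (size w).+2)%N /\
  (('X * b%:P + c%:P) * W k j)`_(size w).+1 = b * (W k j)`_(size w).
  have [szW _] := IHw k j; rewrite -/W in szW.
  have -> : ('X * b%:P + c%:P) * W k j = b *: (W k j * 'X) + c *: W k j.
    by rewrite -!mul_polyC; ring.
  split.
    apply: leq_trans (size_polyD _ _) _; rewrite geq_max; apply/andP; split.
      apply: leq_trans (size_scale_leq _ _) _.
      by apply: leq_trans (size_polyMleq _ _) _; rewrite size_polyX addn2 ltnS.
    by apply: leq_trans (size_scale_leq _ _) _; exact: leq_trans szW _.
  by rewrite coefD !coefZ coefMX /= [(W k j)`_ _.+1]nth_default // mulr0 addr0.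
rewrite !letter_special_mxE -!polyCN.
have [_ W0] := IHw 0 j; have [_ W1] := IHw 1 j.
split.
  apply: leq_trans (size_polyD _ _) _; rewrite geq_max.
  by rewrite (sizeXW _ _ 0).1 (sizeXW _ _ 1).1.
rewrite coefD (sizeXW _ _ 0).2 (sizeXW _ _ 1).2 W0 W1 [in RHS]big_cons mul2E; ring.
Qed.

Lemma size_tr_special_mx w : w != [::] -> path.cycle no_cancel w ->
  size (\tr (word_mx special_mx w)) = (size w).+1.
Proof.
move=> w0 cw; have := tr_prod_rank1_mx w0 cw; rewrite !tr2E => tr0.
have [s0 e0] := word_special_mx w 0 0; have [s1 e1] := word_special_mx w 1 1.
apply/anti_leq/andP; split.
  by apply: leq_trans (size_polyD _ _) _; rewrite geq_max s0.
rewrite ltnNge; apply/negP => /leq_sizeP/(_ _ (leqnn _)).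
rewrite coefD e0 e1 -mulrDr => /eqP; rewrite mulf_eq0 (negPf tr0) orbF; apply/negP.
by rewrite prodf_seq_neq0; apply/allP => m _; rewrite letter_sign_neq0.
Qed.

Lemma det_word_special_mx w : exists2 c, c != 0 &
  \det (word_mx special_mx w) = c *: 'X^(size w).
Proof.
rewrite det_word_mx; elim: w => [|l w [c c0 IHw]].
  by exists 1; [exact: oner_neq0 | rewrite big_nil expr0 scale1r].
rewrite big_cons IHw det_special_mx.
exists ((a (l.1, true) - a (l.1, false)) ^+ 2 * c).
  by rewrite mulf_neq0 // expf_neq0 // subr_eq0 (inj_eq a_inj) xpair_eqE andbF.
by rewrite -scalerAl -scalerAr scalerA -exprS.
Qed.

(** Put n = [size w]. The trace t has degree n and the determinant is c T^n, so t^2, of degree 2n,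
    is not 4 c T^n. Up to the factor c T^(n-1), [ddisc] is 2 T t' - n t, whose coefficient at T^n is
    n times the leading coefficient of t. *)
Lemma discM_special_cyclic w : w != [::] -> path.cycle no_cancel w ->
  (size w)%:R != 0 :> F -> discM (map_mx (@dual_poly F) (word_mx special_mx w)) != 0.
Proof.
move=> w0 cw sw0; have szt := size_tr_special_mx w0 cw.
have [c c0 dE] := det_word_special_mx w.
rewrite /discM trace_map_mx det_map_mx dE; set t := \tr _ in szt *.
have t0 : t != 0 by rewrite -size_poly_eq0 szt.
have szw : (0 < size w)%N by rewrite lt0n size_eq0.
have h0 : c *: 'X^(size w) != 0 :> {poly F}.
  by rewrite scaler_eq0 negb_or c0 -size_poly_eq0 size_polyXn.
rewrite 2?mulf_neq0 //.
  rewrite /disc /= subr_eq0; apply/eqP => E.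
  have := congr1 (fun q : {poly F} => size q) E; rewrite expr2 size_mul // szt.
  move=> szE; have : (size (4 * (c *: 'X^(size w)) : {poly F})%R <= (size w).+1)%N.
    rewrite -[4]/(4%:R) -polyC_natr mul_polyC.
    apply: leq_trans (size_scale_leq _ _) _.
    by apply: leq_trans (size_scale_leq _ _) _; rewrite size_polyXn.
  by rewrite -szE; lia.
have {}dE : ddisc (dual_poly t) (dual_poly (c *: 'X^(size w))) =
    (c *: 'X^((size w).-1)) * (2 * (t^`() * 'X) - (size w)%:R *: t).
  rewrite /ddisc /= derivZ derivXn -{1}(prednK szw) exprS -scaler_nat.
  by rewrite -!mul_polyC rmorph_nat; ring.
rewrite dE mulf_neq0 //; first by rewrite scaler_eq0 negb_or c0 -size_poly_eq0 size_polyXn.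
apply/eqP => /(congr1 (fun q : {poly F} => q`_(size w))).
rewrite coefB coefZ mulr_natl coefMn coefMX (gtn_eqF szw) coef_deriv prednK // coef0.
rewrite -[_ *+ 2]mulr_natl -[t`__ *+ _]mulr_natl => E.
have /eqP : (size w)%:R * t`_(size w) = 0 by rewrite -[RHS]E; ring.
rewrite mulf_eq0 (negPf sw0) /=.
by have := lead_coef_eq0 t; rewrite /lead_coef szt /= => ->; rewrite (negPf t0).
Qed.

End Specialisation.

Lemma discM_word_special (F : fieldType) (X : choiceType) (a : X * bool -> F)
    (R : word X -> word X -> Prop) w :
  injective a -> ~ pres_cong R w [::] ->
  (forall N, (0 < N <= size w)%N -> N%:R != 0 :> F) ->
  discM (word_mx (fun x => map_mx (@dual_poly F) (special_mx a x)) w) != 0.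
Proof.
move=> a_inj wR size_w; have [xs [c [cc cw cE cR]]] := cyclic_reduction w.
have c0 : c != [::].
  by apply/eqP => c0; apply/wR/cR; rewrite c0; exact: PresRefl.
set A := fun x => _; have [tE dE] := cE _ A.
have : discM (word_mx A c) != 0.
  rewrite -word_mx_map; apply: discM_special_cyclic => //.
  by apply: size_w; rewrite cw lt0n size_eq0 c0.
rewrite /discM tE dE; set s := \prod_(x <- xs) _.
have s0 : s.1 != 0.
  have -> : s = dual_poly (\prod_(x <- xs) \det (special_mx a x)).
    by rewrite rmorph_prod; apply: eq_bigr => x _; rewrite det_map_mx.
  rewrite /= prodf_seq_neq0; apply/allP => x _ /=.
  rewrite det_special_mx scaler_eq0 negb_or polyX_eq0 andbT expf_neq0 //.
  by rewrite subr_eq0 (inj_eq a_inj) xpair_eqE andbF.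
(* The three factors of [discM] scale by s^2, s^3 and s^2, which accounts for the exponent 7. *)
have E (x y z b : {poly F}) : x ^+ 2 * y * (x ^+ 3 * z) * (x ^+ 2 * b) =
    x ^+ 7 * (y * z * b) by ring.
rewrite discZ ddiscZ => uv0.
rewrite [(s ^+ 2 * _).1](_ : _ = s.1 ^+ 2 * (\det (word_mx A c)).1).
  by rewrite E mulf_neq0 // expf_neq0.
by rewrite expr2 !dualM.
Qed.

(** * Generic matrices *)

Section GenericMatrices.
Variables (p : nat) (X : finType) (Theta : X -> word X).
Hypothesis p_pr : prime p.

(** The boolean selects the eps-part of an entry when true and the real part when false. *)
Definition entry_index : finType := (X * bool * 'I_2 * 'I_2)%type.
Local Notation n := #|entry_index|.
Local Notation R := {mpoly 'F_p[n]}.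

Definition generic_mx (x : X) : 'M[dual R]_2 :=
  \matrix_(i, j) ('X_(enum_rank (x, false, i, j) : 'I_n),
                  'X_(enum_rank (x, true, i, j) : 'I_n)).

(** The coordinates of the map that replaces each matrix M_x by the value of [Theta x]. *)
Definition generic_subst (k : 'I_n) : R :=
  let: (x, b, i, j) := (enum_val k : entry_index) in
  let z := word_mx generic_mx (Theta x) i j in if b then z.2 else z.1.

Local Notation phi := (mmap (@mpolyC n 'F_p) generic_subst).

Lemma generic_mx_phi x :
  map_mx (dual_map phi) (generic_mx x) = word_mx generic_mx (Theta x).
Proof.
apply/matrixP => i j; rewrite !mxE /dual_map /= !mmapX !mmap1U.
by rewrite /generic_subst !enum_rankK; case: (word_mx _ _ i j).
Qed.

(** Pulling back along the polynomial map is substituting in the word. Nonvanishing on the image of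
    an iterate thus becomes a question about an iterate of theta on w. *)
Lemma discM_phi_iter k w : iter k phi (discM (word_mx generic_mx w)) =
  discM (word_mx generic_mx (iter k (word_subst Theta) w)).
Proof.
elim: k w => [//|k IHk] w.
apply: etrans (iterSr k phi _) _.
rewrite [in RHS]iterSr -IHk.
congr (iter k phi _).
apply: etrans (esym (discM_map phi _)) _.
rewrite word_mx_map.
by rewrite (eq_word_mx w generic_mx_phi) -word_mx_subst.
Qed.

Lemma discM_generic_neq0 (Rel : word X -> word X -> Prop) w : (#|X|.*2 < p)%N ->
  (size w < p)%N -> ~ pres_cong Rel w [::] -> discM (word_mx generic_mx w) != 0.
Proof.
move=> Xp wp wR.
(* Numbering the letters by 2 rank + b gives distinct residues, since 2 #|X| < p. *)
pose a (l : X * bool) : 'F_p := ((enum_rank l.1).*2 + l.2)%:R.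
have natr_inj u v : (u < p)%N -> (v < p)%N -> u%:R = v%:R :> 'F_p -> u = v.
  move=> up vp /(congr1 (fun z : 'F_p => val z)) /=.
  by rewrite !val_Fp_nat // !modn_small.
have a_inj : injective a.
  move=> [x b] [y c]; rewrite /a /= => /natr_inj.
  have := ltn_ord (enum_rank x); have := ltn_ord (enum_rank y) => lty ltx.
  have e1 (z : 'I_#|X|) (b' : bool) : (z.*2 + b' < p)%N.
    by apply: leq_trans Xp; case: b'; have := ltn_ord z; lia.
  move/(_ (e1 _ _) (e1 _ _)) => E.
  have Eb : b = c.
    by move/(congr1 odd): E; rewrite !oddD !odd_double; case: (b) (c) => [] [].
  congr (_, _) => //; apply: enum_rank_inj; apply: val_inj => /=.
  by move: E; rewrite Eb => /addIn; lia.
pose sp : R -> {poly 'F_p} := mmap (@polyC 'F_p) (fun k : 'I_n =>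
  let: (x, b, i, j) := (enum_val k : entry_index) in
  if b then (special_mx a x i j)^`() else special_mx a x i j).
have spE x : map_mx (dual_map sp) (generic_mx x) = map_mx (@dual_poly _) (special_mx a x).
  apply/matrixP => i j; rewrite [LHS]mxE [RHS]mxE.
  rewrite [generic_mx x i j]mxE /dual_map /dual_poly.
  rewrite /= /sp.
  rewrite !mmapX !mmap1U.
  by rewrite !enum_rankK.
have : discM (word_mx (fun x => map_mx (@dual_poly _) (special_mx a x)) w) != 0.
  apply: (discM_word_special a_inj wR) => N /andP [N0 Nw].
  rewrite -(dvdn_pcharf (pchar_Fp p_pr)) gtnNdvd //.
  exact: leq_ltn_trans wp.
rewrite -(eq_word_mx w spE) -word_mx_map discM_map.
by apply: contraNneq => ->; rewrite rmorph0.
Qed.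

End GenericMatrices.

Lemma quasi_fixed_matrices (X : finType) (Theta : X -> word X)
    (Rel : word X -> word X -> Prop) (ws : seq (word X)) :
  (forall k w, w \in ws -> ~ pres_cong Rel (iter k (word_subst Theta) w) [::]) ->
  exists (p : nat) (L : finFieldType) (iota : {rmorphism 'F_p -> L}) (m : nat)
    (A : X -> 'M[dual L]_2),
    [/\ prime p, (2 < p)%N,
      forall x i j, word_mx A (Theta x) i j =
        ((A x i j).1 ^+ (p ^ m), (A x i j).2 ^+ (p ^ m))
    & forall w, w \in ws -> discM (word_mx A w) != 0].
Proof.
(* The number n of coordinates, which is also the number of iterations, does not depend on p; so p
   can be chosen afterwards. It must exceed 2 #|X|, the number 2, and the lengths of the n-th
   substitutes of the words. *)
move=> wsR; pose n := #|entry_index X|.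
pose bound := (#|X|.*2 + 2 + \sum_(w <- ws) size (iter n (word_subst Theta) w))%N.
have [p bp p_pr] := prime_above bound.
have size_ws w : w \in ws -> (size (iter n (word_subst Theta) w) < p)%N.
  move=> ww; apply: leq_ltn_trans bp; rewrite /bound (big_rem w) //=; lia.
(* A single product, so that one point serves all the words. *)
pose g : {mpoly 'F_p[n]} := \prod_(w <- ws) discM (word_mx (generic_mx p (X := X)) w).
have [|L [e [m [eX eg]]]] := @quasi_fixed_point p n (generic_subst p Theta) p_pr g.
  rewrite /g; set phi := mmap _ _.
  have phi_prod k (F : word X -> {mpoly 'F_p[n]}) :
      iter k phi (\prod_(w <- ws) F w) = \prod_(w <- ws) iter k phi (F w).
    by elim: k => //= k ->; rewrite /phi rmorph_prod.
  rewrite phi_prod prodf_seq_neq0; apply/allP => w ww /=.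
  rewrite discM_phi_iter; apply: (@discM_generic_neq0 _ _ p_pr Rel).
  - by apply: leq_ltn_trans bp; rewrite /bound; lia.
  - exact: size_ws.
  - exact: wsR.
exists p, L, (e \o @mpolyC n 'F_p), m, (fun x => map_mx (dual_map e) (generic_mx p x)).
split=> //; first by apply: leq_ltn_trans bp; rewrite /bound; lia.
  move=> x i j; rewrite -word_mx_map !mxE /dual_map /=.
  have := eX (enum_rank (x, false, i, j)); have := eX (enum_rank (x, true, i, j)).
  rewrite /generic_subst !enum_rankK. by move=> <- <-.
move=> w ww; rewrite -word_mx_map discM_map; move: eg; rewrite /g rmorph_prod.
by rewrite prodf_seq_neq0 => /allP /(_ _ ww).
Qed.

(** * Congruence subgroup of level eps *)

Section InfinitesimalMx.
Variable R : comNzRingType.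
Implicit Types (Y Z W : 'M[R]_2) (A B D : 'M[dual R]_2).

Definition cst_mx Z : 'M[dual R]_2 := map_mx (@dual_cst R) Z.
Definition eps_mx Y : 'M[dual R]_2 := map_mx (fun y => (0, y) : dual R) Y.
Definition re_mx D : 'M[R]_2 := map_mx (@dual_re R) D.

Definition dual_mx Z W : 'M[dual R]_2 := cst_mx Z + eps_mx W.

Lemma mul_mx_eps D Y : D * eps_mx Y = eps_mx (re_mx D * Y).
Proof.
apply/matrixP => i j; rewrite mul2E [RHS]mxE mul2E !mxE !dualM dualD /=.
by congr pair; rewrite /dual_re; ring.
Qed.

Lemma mul_eps_mx D Y : eps_mx Y * D = eps_mx (Y * re_mx D).
Proof.
apply/matrixP => i j; rewrite mul2E [RHS]mxE mul2E !mxE !dualM dualD /=.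
by congr pair; rewrite /dual_re; ring.
Qed.

Lemma eps_mxD Y W : eps_mx (Y + W) = eps_mx Y + eps_mx W.
Proof. by apply/matrixP => i j; rewrite !mxE dualD /= addr0. Qed.

Lemma eps_mxN Y : eps_mx (- Y) = - eps_mx Y.
Proof. by apply/matrixP => i j; rewrite !mxE dualN /= oppr0. Qed.

Lemma re_eps_mx Y : re_mx (eps_mx Y) = 0.
Proof. by apply/matrixP => i j; rewrite !mxE. Qed.

Lemma re_cst_mx Z : re_mx (cst_mx Z) = Z.
Proof. by apply/matrixP => i j; rewrite !mxE. Qed.

Lemma re_mxD D D' : re_mx (D + D') = re_mx D + re_mx D'.
Proof. exact: map_mxD. Qed.

Lemma re_mxM D D' : re_mx (D * D') = re_mx D * re_mx D'.
Proof. exact: map_mxM. Qed.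

Lemma re_mx_adj D : re_mx (\adj D) = \adj (re_mx D).
Proof. exact: map_mx_adj. Qed.

Lemma re_mx_commutator A B :
  re_mx (A * B * \adj A * \adj B) = re_mx A * re_mx B * \adj (re_mx A) * \adj (re_mx B).
Proof.
by rewrite (re_mxM _ (\adj B)) (re_mxM _ (\adj A)) (re_mxM A B) (re_mx_adj A) (re_mx_adj B).
Qed.

Lemma re_mx1 : re_mx 1 = 1.
Proof. exact: map_mx1. Qed.

Lemma conj_eps_mx Y Z W : (1 - eps_mx Y) * dual_mx Z W * (1 + eps_mx Y) =
  dual_mx Z (W + (Z * Y - Y * Z)).
Proof.
rewrite /dual_mx mulrDr mulr1 mul_mx_eps mulrBl mul1r mul_eps_mx re_mxD.
rewrite re_cst_mx re_eps_mx addr0.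
rewrite !re_mxD re_cst_mx -eps_mxN !re_eps_mx !addr0 !eps_mxD -!addrA.
by congr (_ + (_ + _)); rewrite addrC.
Qed.

End InfinitesimalMx.

(** * Matrix powers congruent to 1 modulo eps *)

Lemma dualX (R : comNzRingType) (x : dual R) k :
  x ^+ k.+1 = (x.1 ^+ k.+1, k.+1%:R * x.1 ^+ k * x.2).
Proof.
elim: k => [|k IHk]; first by rewrite !expr1 expr0 !mul1r; case: x.
by rewrite exprS IHk dualM /= -exprS; congr pair; rewrite -[k.+2%:R]natr1 exprS; ring.
Qed.

Definition dual_inv (F : fieldType) (x : dual F) : dual F :=
  (x.1^-1, - x.2 / x.1 ^+ 2).

Lemma dual_mulVx (F : fieldType) (x : dual F) : x.1 != 0 -> dual_inv x * x = 1.
Proof. by move=> x0; rewrite dualM; congr pair => /=; field. Qed.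

(** One entry of the identity 2 D (1 + eps Y) = u C + v of [mx_pow_congruence]: x is the entry of D,
    e marks the diagonal, and the factor t x - d e is the entry of the square of the real part, by
    Cayley-Hamilton. *)
Lemma pow_entry (R : comNzRingType) (s be : R) (x t d : dual R) (e : bool) :
  2 * d.1 * be = s * t.1 + t.2 ->
  2 * x + ((0, 2 * ((s - be * t.1) * x.1 + be * (t.1 * x.1 - d.1 * e%:R))) : dual R)
  = ((1, s) : dual R) * (2 * x - t *+ e) + ((t.1, 0) : dual R) *+ e.
Proof.
case: x t d => x1 x2 [t1 t2] [d1 d2] /= E.
have -> : t2 = 2 * d1 * be - s * t1 by rewrite E; ring.
by case: e; rewrite ?mulr1n ?mulr0n; congr pair => /=; ring.
Qed.

Lemma exprD_pchar_comm (R : nzRingType) p N (x y : R) :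
  p \in [pchar R] -> GRing.comm x y -> (x + y) ^+ (p ^ N) = x ^+ (p ^ N) + y ^+ (p ^ N).
Proof.
move=> pR xy; elim: N => [|N IHN]; first by rewrite expn0 !expr1.
rewrite expnSr !exprM IHN -!(pFrobenius_autE pR) pFrobenius_autD_comm //.
by apply: commrX; apply/commr_sym/commrX/commr_sym.
Qed.

Section PowerCongruence.
Variables (L : fieldType) (p N : nat).
Hypothesis (pL : p \in [pchar L]) (p_odd : odd p) (N_gt0 : (0 < N)%N).
Hypothesis expL : forall x : L, x ^+ (p ^ N) = x.
Let q := (p ^ N)%N.

Let two_neq0 : 2 != 0 :> L.
Proof.
rewrite -[2]/(2%:R) -(dvdn_pcharf pL).
have p_pr := pcharf_prime pL; apply/negP => /dvdn_leq; move: p_odd (prime_gt1 p_pr).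
by case: (p) => [|[|[|]]] //= n _ _ /(_ isT).
Qed.

(** Write 2 D = C + t with C^2 = [Del] scalar. In characteristic p this gives 2 D^(q^2) = C^(q^2) +
    t^(q^2) = [Del]^M C + t.1, where q^2 = 2M + 1. So D^(q^2) is an explicit linear expression in D,
    to be matched with D (1 + eps Y). *)
Lemma mx_pow_congruence (D : 'M[dual L]_2) : discM D != 0 ->
  exists al be, be != 0 /\
    D ^+ (q ^ 2).-1 = 1 + eps_mx (al *: 1 + be *: re_mx D).
Proof.
have q_odd : odd q by rewrite oddX p_odd orbT.
have q0 : (0 < q)%N by case: (q) q_odd.
have qR : q%:R = 0 :> L by rewrite natrX (pcharf0 pL) expr0n eqn0Ngt N_gt0.
set B := re_mx D; set t := \tr D; set d := \det D.
rewrite /discM -/t -/d !mulf_eq0 !negb_or => /andP [/andP [dd0 del0] d0].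
pose Del : dual L := t ^+ 2 - 4 * d.
have Del1 : Del.1 = disc t d by rewrite /Del /disc expr2 !dualM dualD /=; ring.
have Del2 : Del.2 = 2 * t.1 * t.2 - 4 * d.2.
  by rewrite /Del expr2 !dualM dualD /=; ring.
pose C : 'M[dual L]_2 := 2 *: D - t%:M.
have CC : C * C = Del%:M.
  by apply: mx2P; rewrite /Del /C /t /d !mx2E /=; ring.
have Cexp k : C ^+ k.*2.+1 = Del ^+ k *: C.
  rewrite exprS -mul2n exprM expr2 CC -(rmorphXn (@scalar_mx _ 2)) -mulmxE.
  by rewrite mul_mx_scalar.
(* M = (q^2 - 1)/2 is a multiple of q - 1, so [Del.1] to the power M is 1 whether or not [Del.1] is
   a square; the exponent (q - 1)/2 would leave a sign. *)
pose M := ((q.-1) * (q.+1)./2)%N.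
have q2 : (q ^ 2 = M.*2.+1)%N.
  rewrite /M -mul2n mulnCA mul2n halfK /= q_odd subn0.
  by case: (q) q0 => // k _ /=; rewrite expnS expn1; lia.
have q_gt1 : (1 < q)%N by rewrite -(exp1n N) ltn_exp2r // prime_gt1 // (pcharf_prime pL).
have M_gt0 : (0 < M)%N by rewrite /M muln_gt0; apply/andP; split; lia.
have DelM : Del.1 ^+ M = 1.
  have : Del.1 ^+ q.-1 = 1.
    have D10 : Del.1 != 0 by rewrite Del1.
    by apply: (mulfI D10); rewrite mulr1 -exprS prednK // expL.
  by rewrite /M exprM => ->; rewrite expr1n.
have twoM : 2 * M%:R + 1 = 0 :> L.
  have : (q ^ 2)%:R = 0 :> L by rewrite natrX qR expr0n.
  by rewrite q2 -natr1 -mul2n natrM.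
(* The eps-part of [Del]^M is M [Del.1]^(M-1) [Del.2], and M = -1/2 in L. *)
pose s : L := - Del.2 / (2 * Del.1).
have DelE : Del ^+ M = (1, s).
  rewrite -(prednK M_gt0) dualX prednK // DelM; congr pair.
  have D10 : Del.1 != 0 by rewrite Del1.
  have DelM1 : Del.1 ^+ M.-1 = Del.1^-1.
    by apply: (mulfI D10); rewrite -exprS prednK // DelM mulfV.
  rewrite DelM1 /s; have -> : M%:R = - (2^-1) :> L.
    apply: (mulfI two_neq0); rewrite mulrN mulfV //; apply/eqP.
    by rewrite -addr_eq0 twoM.
  by field; rewrite two_neq0 D10.
have expq2 (x : dual L) : x ^+ (q ^ 2) = (x.1, 0).
  have q20 : (0 < q ^ 2)%N by rewrite expn_gt0 q0.
  rewrite -(prednK q20) dualX prednK // natrX qR expr0n !mul0r.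
  by rewrite expnS expn1 exprM !expL.
have pcharM : p \in [pchar 'M[dual L]_2].
  have pdual := rmorph_pchar (@dual_cst L) pL.
  exact: (rmorph_pchar (@scalar_mx (dual L) 2) pdual).
pose u : dual L := (1, s); pose v : dual L := (t.1, 0).
have E : 2 *: D ^+ (q ^ 2) = u *: C + v%:M.
  have : (2 *: D) ^+ (q ^ 2) = C ^+ (q ^ 2) + t%:M ^+ (q ^ 2).
    have {1}-> : 2 *: D = C + t%:M by rewrite /C subrK.
    have -> : (q ^ 2 = p ^ (N * 2))%N by rewrite /q -expnM.
    have Ct : GRing.comm C (t%:M : 'M_2) by rewrite /GRing.comm -!mulmxE scalar_mxC.
    exact: (exprD_pchar_comm (N * 2) pcharM Ct).
  have two2 : (2 : dual L) ^+ (q ^ 2) = 2.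
    by rewrite expq2; congr pair; rewrite /= addr0.
  rewrite exprZn two2 -(rmorphXn (@scalar_mx _ 2)) /= expq2 => ->.
  by rewrite q2 Cexp DelE.
(* Comparing eps-parts of 2 D (1 + eps Y) and u C + v requires al + be t = s and 2 d be = s t + t',
   with t, d real parts and t' the eps-part of the trace. *)
pose be := (s * t.1 + t.2) / (2 * d.1); pose al := s - be * t.1.
have be0 : be != 0.
  rewrite /be mulf_neq0 ?invr_eq0 ?mulf_neq0 //; apply: contra_neq del0 => st0.
  have D10 : Del.1 != 0 by rewrite Del1.
  (* The right side equals -4 [ddisc t d], so the numerator of [be] cannot vanish. *)
  have : 2 * Del.1 * (s * t.1 + t.2) = 2 * t.2 * Del.1 - Del.2 * t.1.
    by rewrite /s; field; rewrite two_neq0 D10.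
  rewrite st0 mulr0 Del2 Del1 /ddisc /disc => /esym e.
  have : 4 * ddisc t d = 0.
    rewrite -[RHS]oppr0 -e /ddisc; ring.
  have four0 : 4 != 0 :> L by rewrite (_ : 4 = 2 * 2) ?mulf_neq0 //; ring.
  by move/eqP; rewrite mulf_eq0 (negPf four0) => /eqP.
exists al, be; split=> //; set Y := al *: 1 + be *: B.
have d0two : 2 * d.1 * be = s * t.1 + t.2.
  by rewrite /be mulrC divfK // mulf_neq0.
have trB : \tr B = t.1 by rewrite /B /re_mx trace_map_mx.
have detB : \det B = d.1 by rewrite /B /re_mx det_map_mx.
have BB i j : (B * B) i j = t.1 * B i j - d.1 * (i == j)%:R.
  by rewrite -trB -detB; move: i j; apply: I2_ind; rewrite !mx2E /=; ring.
have DT : 2 *: (D * (1 + eps_mx Y)) = u *: C + v%:M.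
  rewrite mulrDr mulr1 mul_mx_eps -/B scalerDr.
  have BY i j : (B * Y) i j = al * B i j + be * (t.1 * B i j - d.1 * (i == j)%:R).
    by rewrite /Y mulrDr -!scalerAr mulr1 -BB !mxE.
  have e2 : 2 *: eps_mx (B * Y) = eps_mx (2 *: (B * Y)).
    by apply/matrixP => i j; rewrite !mxE dualM /=; congr pair; ring.
  rewrite e2; apply/matrixP => i j; rewrite [LHS]mxE [X in _ + X]mxE [X in (_, X)]mxE BY.
  have -> : B i j = (D i j).1 by rewrite mxE.
  rewrite /C [RHS]mxE [X in X + _ = _]mxE [X in _ = X + _]mxE.
  rewrite [X in u * X]mxE [X in u * (X + _)]mxE [X in u * (_ + X)]mxE [X in u * (_ - X)]mxE.
  by rewrite [v%:M i j]mxE; exact: pow_entry.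
have dT : (2 * d) *: D ^+ (q ^ 2).-1 = (2 * d) *: (1 + eps_mx Y).
  have dE (X : 'M[dual L]_2) : (2 * d) *: X = \adj D * (2 *: (D * X)).
    have aD : \adj D * D = d%:M := mul_adj_mx D.
    have dX : d%:M * X = d *: X := mul_scalar_mx d X.
    by rewrite -scalerAr mulrA aD dX scalerA.
  by rewrite !dE DT -E -exprS prednK // expn_gt0 q0.
have twod : dual_inv (2 * d) * (2 * d) = 1.
  by apply: dual_mulVx; rewrite dualM /= mulf_neq0.
by rewrite -[LHS]scale1r -twod -scalerA dT scalerA twod scale1r.
Qed.

End PowerCongruence.

(** * The finite quotient *)

Section Conjugation.
Variable L : fieldType.
Implicit Types (D E Z : 'M[dual L]_2) (Y B : 'M[L]_2).

(** For invertible D this is D^-1 Z D; the side is chosen so that the product of permutations,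
    applied left to right, corresponds to the product of matrices. *)
Definition conj_fun D Z : 'M[dual L]_2 := dual_inv (\det D) *: (\adj D * Z * D).

Lemma dual_invM (x y : dual L) : x.1 != 0 -> y.1 != 0 ->
  dual_inv (x * y) = dual_inv y * dual_inv x.
Proof.
by move=> x0 y0; rewrite !dualM; congr pair => /=; field; rewrite ?x0 ?y0.
Qed.

Lemma det_mul_neq0 D E : (\det D).1 != 0 -> (\det E).1 != 0 -> (\det (D * E)).1 != 0.
Proof. by move=> D0 E0; rewrite detM dualM mulf_neq0. Qed.

Lemma det_adj_neq0 D : (\det D).1 != 0 -> (\det (\adj D)).1 != 0.
Proof. by rewrite det2_adj. Qed.

Lemma conj_funM D E Z : (\det D).1 != 0 -> (\det E).1 != 0 ->
  conj_fun E (conj_fun D Z) = conj_fun (D * E) Z.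
Proof.
move=> D0 E0; rewrite /conj_fun detM (dual_invM D0 E0) adj2M.
by rewrite -scalerAr -scalerAl scalerA !mulrA.
Qed.

Lemma conj_fun_unit D E Z : E * D = 1 -> (\det D).1 != 0 -> conj_fun D Z = E * Z * D.
Proof.
move=> ED D0; rewrite /conj_fun.
have DE : D * E = 1 by move: ED; rewrite -!mulmxE => /mulmx1C.
have -> : E = dual_inv (\det D) *: \adj D.
  have aD : \adj D * D = (\det D)%:M := mul_adj_mx D.
  have dX : (\det D)%:M * E = \det D *: E := mul_scalar_mx _ E.
  rewrite -[\adj D]mulr1 -DE mulrA aD dX scalerA dual_mulVx // scale1r //.
by rewrite -!scalerAl.
Qed.

Lemma conj_fun1 Z : conj_fun 1 Z = Z.
Proof. by rewrite (@conj_fun_unit _ 1) ?mul1r ?mulr1 // det1 oner_neq0. Qed.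

Lemma conj_fun_adjK D : (\det D).1 != 0 -> cancel (conj_fun D) (conj_fun (\adj D)).
Proof.
move=> D0 Z; rewrite conj_funM ?det_adj_neq0 //.
have aD : D * \adj D = (\det D)%:M := mul_mx_adj D.
have dV : dual_inv (\det D) * \det D = 1 by exact: dual_mulVx.
rewrite aD (@conj_fun_unit _ (dual_inv (\det D))%:M).
- have sX (x : dual L) (W : 'M[dual L]_2) : x%:M * W = x *: W := mul_scalar_mx x W.
  have Xs (x : dual L) (W : 'M[dual L]_2) : W * x%:M = x *: W
    by rewrite -mulmxE mul_mx_scalar.
  by rewrite Xs sX scalerA mulrC dV scale1r.
- by rewrite -mulmxE -scalar_mxM dV.
- by rewrite det_scalar expr2 dualM mulf_neq0.
Qed.

Lemma conj_fun_inj D : (\det D).1 != 0 -> injective (conj_fun D).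
Proof. by move=> D0; apply: can_inj (conj_fun_adjK D0). Qed.

End Conjugation.

HB.instance Definition _ (L : finFieldType) := Finite.copy (dual L) (L * L)%type.

(** A non-injective f gets the identity as default value. *)
HB.lock Definition perm_of_fun (T : finType) (f : T -> T) : {perm T} :=
  insubd (1%g : {perm T}) (finfun f).

Lemma perm_of_funE (T : finType) (f : T -> T) :
  injective f -> forall x, perm_of_fun f x = f x.
Proof.
move=> f_inj x; have inj : injectiveb (finfun f).
  by apply/injectiveP => y z; rewrite !ffunE; exact: f_inj.
by rewrite perm_of_fun.unlock -pvalE val_insubd inj ffunE.
Qed.

Section PermOfFun.
Variables (T : finType) (f g h : T -> T).
Hypothesis f_inj : injective f.

Lemma perm_of_funM : injective g -> (forall x, g (f x) = h x) ->
  (perm_of_fun f * perm_of_fun g)%g = perm_of_fun h.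
Proof.
move=> g_inj fgh; have h_inj : injective h.
  by move=> x y; rewrite -!fgh => /g_inj /f_inj.
by apply/permP => x; rewrite permM !perm_of_funE.
Qed.

Lemma perm_of_fun1 : f =1 id -> perm_of_fun f = 1%g.
Proof. by move=> fid; apply/permP => x; rewrite perm1 perm_of_funE. Qed.

Lemma perm_of_funV : injective g -> cancel f g -> perm_of_fun g = (perm_of_fun f)^-1%g.
Proof.
by move=> g_inj fK; apply/esym/mulg1_eq/permP => x; rewrite permM perm1 !perm_of_funE.
Qed.

Lemma perm_of_fun_conj : injective g -> injective h ->
  (forall x, g (f x) = h (g x)) ->
  ((perm_of_fun g)^-1 * perm_of_fun f * perm_of_fun g)%g = perm_of_fun h.
Proof.
move=> g_inj h_inj gfh; apply: (mulgI (perm_of_fun g)); rewrite -mulgA mulKVg.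
by apply/permP => x; rewrite !permM !perm_of_funE.
Qed.

End PermOfFun.

Section ConjPerm.
Variable L : finFieldType.
Implicit Types (D E : 'M[dual L]_2) (Y Z W : 'M[L]_2).

Definition conj_perm D : {perm 'M[dual L]_2} := perm_of_fun (conj_fun D).

Lemma conj_permE D (Z : 'M[dual L]_2) : (\det D).1 != 0 -> conj_perm D Z = conj_fun D Z.
Proof. by move=> D0; exact: (perm_of_funE (conj_fun_inj D0) Z). Qed.

Lemma conj_permM D E : (\det D).1 != 0 -> (\det E).1 != 0 ->
  (conj_perm D * conj_perm E)%g = conj_perm (D * E).
Proof.
move=> D0 E0; apply: (perm_of_funM (conj_fun_inj D0) (conj_fun_inj E0)) => Z.
exact: conj_funM.
Qed.

Lemma conj_perm1 : conj_perm 1 = 1%g.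
Proof.
have d1 : (\det (1 : 'M[dual L]_2)).1 != 0 by rewrite det1 oner_neq0.
exact: (perm_of_fun1 (conj_fun_inj d1) (@conj_fun1 L)).
Qed.

Lemma conj_perm_adj D : (\det D).1 != 0 -> conj_perm (\adj D) = (conj_perm D)^-1%g.
Proof.
move=> D0; have A0 := conj_fun_inj (det_adj_neq0 D0).
exact: (perm_of_funV (conj_fun_inj D0) A0 (conj_fun_adjK D0)).
Qed.

(** Adjugate and inverse differ by a scalar, which conjugation ignores; hence the polynomial
    evaluation of words computes the group-theoretic one. *)
Lemma word_conj_perm (X : choiceType) (A : X -> 'M[dual L]_2) w :
  (forall x, (\det (A x)).1 != 0) ->
  word_val (fun x => conj_perm (A x)) w = conj_perm (word_mx A w) /\
  (\det (word_mx A w)).1 != 0.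
Proof.
move=> A0; elim: w => [|l w [IHw w0]].
  by rewrite /word_val /word_mx !big_nil conj_perm1 det1 oner_neq0.
have l0 : (\det (letter_mx A l)).1 != 0 by rewrite det_letter_mx.
rewrite word_mx_cons; split; last exact: det_mul_neq0.
rewrite /word_val big_cons -/(word_val _ w) IHw -(conj_permM l0 w0).
rewrite /letter_val /letter_mx; case: l.2; first exact: erefl.
by rewrite (conj_perm_adj (A0 _)).
Qed.

Let commD Z Y W : Z * (Y + W) - (Y + W) * Z = (Z * Y - Y * Z) + (Z * W - W * Z).
Proof. by rewrite mulrDr mulrDl opprD addrACA. Qed.

(** This is the action of conjugation by 1 + eps Y. It determines Y only up to scalar matrices, so
    additive functions are read off from the commutators [Z, Y]. *)
Definition eps_perm (s : {perm 'M[dual L]_2}) := exists Y, forall Z W,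
  s (dual_mx Z W) = dual_mx Z (W + (Z * Y - Y * Z)).

Lemma eps_perm1 : eps_perm 1%g.
Proof. by exists 0 => Z W; rewrite perm1 mulr0 mul0r subrr addr0. Qed.

Lemma eps_permM s t : eps_perm s -> eps_perm t -> eps_perm (s * t)%g.
Proof.
move=> [Y sY] [Y' tY']; exists (Y + Y') => Z W; rewrite permM sY tY'.
by rewrite commD !addrA.
Qed.

Lemma eps_permV s : eps_perm s -> eps_perm s^-1%g.
Proof.
move=> [Y sY]; exists (- Y) => Z W; apply: (@perm_inj _ s).
by rewrite permKV sY -addrA -commD addNr mulr0 mul0r subrr addr0.
Qed.

Lemma eps_perm_conj Y Z W : conj_perm (1 + eps_mx Y) (dual_mx Z W) =
  dual_mx Z (W + (Z * Y - Y * Z)).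
Proof.
have E : (1 - eps_mx Y) * (1 + eps_mx Y) = 1.
  rewrite mulrDr mulr1 mul_mx_eps re_mxD re_mx1 -eps_mxN re_eps_mx addr0 mul1r.
  by rewrite eps_mxN subrK.
have d0 : (\det (1 + eps_mx Y)).1 != 0.
  have -> : (\det (1 + eps_mx Y)).1 = \det (re_mx (1 + eps_mx Y)) by rewrite det_map_mx.
  by rewrite re_mxD re_mx1 re_eps_mx addr0 det1 oner_neq0.
by rewrite (conj_permE _ d0) (conj_fun_unit _ E d0) conj_eps_mx.
Qed.

End ConjPerm.

(** * The congruence subgroup and its first homology *)

Section CongruenceSubgroup.
Variables (L : finFieldType) (G : groupType).
Variable Phi : {multiplicative G -> {perm 'M[dual L]_2}}.

Definition eps_subgroup (g : G) : bool := `[< eps_perm (Phi g) >].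

Fact eps_subgroup1 : 1%g \in (eps_subgroup : {pred G}).
Proof. by apply/asboolP; rewrite multiplicative1; exact: eps_perm1. Qed.

Fact eps_subgroupM : {in (eps_subgroup : {pred G}) &, forall x y,
  (x * y)%g \in (eps_subgroup : {pred G})}.
Proof.
by move=> x y /asboolP sx /asboolP sy; apply/asboolP; rewrite gmulfM; exact: eps_permM.
Qed.

Fact eps_subgroupV : {in (eps_subgroup : {pred G}), forall x,
  (x^-1)%g \in (eps_subgroup : {pred G})}.
Proof.
by move=> x /asboolP sx; apply/asboolP; rewrite multiplicativeV; exact: eps_permV.
Qed.

Definition eps_group : groupClosed G := HB.pack_for (groupClosed G) eps_subgroup
  (isMulClosed.Build G eps_subgroup eps_subgroupM)
  (isMul1Closed.Build G eps_subgroup eps_subgroup1)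
  (isInvClosed.Build G eps_subgroup eps_subgroupV).

Lemma eps_group_finite_index : finite_index eps_group.
Proof.
(* One preimage for each permutation, with 1 as default outside the image of [Phi]. *)
pose pre (s : {perm 'M[dual L]_2}) : G :=
  if pselect (exists g, Phi g = s) is left e then proj1_sig (cid e) else 1%g.
exists [seq pre s | s <- enum {perm 'M[dual L]_2}] => g.
exists (pre (Phi g)); first by apply: map_f; rewrite mem_enum.
have E : Phi (pre (Phi g)) = Phi g.
  rewrite /pre; case: pselect => [e|[]]; last by exists g.
  by case: (cid e).
by apply/asboolP; rewrite gmulfM multiplicativeV E mulVg; exact: eps_perm1.
Qed.

(** A linear relation among the three classes makes the combination T of the matrices Y central.
    Expanding [B1, T] and [B2, T] in terms of the invertible N = [B1, B2] then removes the
    coefficients one by one. *)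
Lemma eps_group_homology (k : fieldType) (iota : {rmorphism k -> L}) (g1 g2 g3 : G)
    (B1 B2 : 'M[L]_2) (al1 al2 al3 be1 be2 be3 : L) :
  Phi g1 = conj_perm (1 + eps_mx (al1 *: 1 + be1 *: B1)) -> be1 != 0 ->
  Phi g2 = conj_perm (1 + eps_mx (al2 *: 1 + be2 *: B2)) -> be2 != 0 ->
  Phi g3 = conj_perm (1 + eps_mx (al3 *: 1 + be3 *: (B1 * B2))) -> be3 != 0 ->
  \det (B1 * B2 - B2 * B1) != 0 ->
  homology_dim_ge (subgroup eps_group) k 1 3.
Proof.
move=> Pg1 b1 Pg2 b2 Pg3 b3 detN.
pose Y (i : 'I_3) : 'M[L]_2 := nth 0 [:: al1 *: 1 + be1 *: B1;
  al2 *: 1 + be2 *: B2; al3 *: 1 + be3 *: (B1 * B2)] i.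
pose g (i : 'I_3) : G := nth 1%g [:: g1; g2; g3] i.
have PhiY i : Phi (g i) = conj_perm (1 + eps_mx (Y i)).
  case: i => m; case: m => [hm|[hm|[hm|m hm]]].
  - exact: Pg1.
  - exact: Pg2.
  - exact: Pg3.
  - by exfalso.
have gH i : g i \in eps_group.
  by apply/asboolP; exists (Y i) => Z W; rewrite PhiY eps_perm_conj.
pose h (i : 'I_3) : subgroup eps_group := exist _ (g i) (gH i).
pose mu (Z : 'M[L]_2 * ('I_2 * 'I_2)) (x : subgroup eps_group) : L :=
  (Phi (val x) (dual_mx Z.1 0) Z.2.1 Z.2.2).2.
have muE Z x Y' : (forall Z W, Phi (val x) (dual_mx Z W) =
    dual_mx Z (W + (Z * Y' - Y' * Z))) ->
    mu Z x = (Z.1 * Y' - Y' * Z.1) Z.2.1 Z.2.2.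
  move=> xY; rewrite /mu xY add0r.
  by rewrite 3!mxE dualD /= add0r.
have muM Z : {morph mu Z : x y / (x * y)%g >-> x + y}.
  move=> x y; have /asboolP [Y1 xY1] := valP x; have /asboolP [Y2 yY2] := valP y.
  rewrite (muE _ _ _ xY1) (muE _ _ _ yY2) (muE _ _ (Y1 + Y2)).
    by rewrite mulrDr mulrDl opprD addrACA mxE.
  move=> Z' W; have -> : val (x * y)%g = (val x * val y)%g by [].
  rewrite gmulfM permM xY1 yY2.
  by rewrite mulrDr mulrDl opprD [X in _ = dual_mx _ (_ + X)]addrACA !addrA.
apply: (@homology1_dim_ge _ _ _ _ iota mu muM _ h) => a aE.
pose T : 'M[L]_2 := \sum_l iota (a l) *: Y l.
have comT Z : Z * T - T * Z = 0.
  apply/matrixP => i j; rewrite [RHS]mxE -[RHS](aE (Z, (i, j))).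
  rewrite mulr_sumr mulr_suml -sumrB summxE; apply: eq_bigr => l _.
  rewrite (muE _ (h l) (Y l)) /= => [|Z' W]; last by rewrite PhiY eps_perm_conj.
  by rewrite -scalerAr -scalerAl -scalerBr mxE.
pose c (l : 'I_3) := iota (a l).
pose a0 := c 0 * al1 + c 1 * al2 + c (inord 2) * al3.
pose x1 := c 0 * be1; pose x2 := c 1 * be2; pose x3 := c (inord 2) * be3.
have TE : T = a0 *: 1 + x1 *: B1 + x2 *: B2 + x3 *: (B1 * B2).
  rewrite /T !big_ord_recl big_ord0 /Y /=.
  have -> : lift ord0 (lift ord0 ord0) = inord 2 :> 'I_3.
    by apply: val_inj; rewrite /= inordK.
  have -> : lift ord0 ord0 = 1 :> 'I_3 by exact: val_inj.
  rewrite -/(c _) -/(c 1) -/(c (inord 2)) /a0 /x1 /x2 /x3.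
  by apply/matrixP => i j; rewrite !mxE; ring.
pose N := B1 * B2 - B2 * B1.
have NadjN : N * \adj N = (\det N)%:M := mul_mx_adj N.
have NI (U : 'M[L]_2) : U * N = 0 -> U = 0.
  move=> UN; have : U * N * \adj N = 0 by rewrite UN mul0r.
  rewrite -mulrA NadjN -mulmxE mul_mx_scalar => /eqP.
  by rewrite scaler_eq0 (negPf detN) => /eqP.
have ZI (x : L) : x *: N = 0 -> x = 0.
  move/eqP; rewrite scaler_eq0 => /orP [/eqP //|/eqP N0].
  by move: detN; rewrite -/N N0 det0 eqxx.
(* [B1, T] = (x2 + x3 B1) N, and N is invertible; commuting the first factor with B2 next isolates
   x3 N. *)
have U0 : x2 *: 1 + x3 *: B1 = 0.
  apply: NI; rewrite -[RHS](comT B1) TE /N.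
  by apply: mx2P; rewrite !mx2E /=; ring.
have x30 : x3 = 0.
  apply: ZI; transitivity ((x2 *: 1 + x3 *: B1) * B2 - B2 * (x2 *: 1 + x3 *: B1)).
    by rewrite /N; apply: mx2P; rewrite !mx2E /=; ring.
  by rewrite U0 mul0r mulr0 subrr.
have x20 : x2 = 0.
  move: U0; rewrite x30 scale0r addr0 => /eqP.
  by rewrite scaler_eq0 oner_eq0 orbF => /eqP.
have x10 : x1 = 0.
  apply: ZI; rewrite -[RHS]oppr0 -(comT B2) TE x20 x30 /N.
  by apply: mx2P; rewrite !mx2E /=; ring.
have c0 l x : c l * x = 0 -> x != 0 -> a l = 0.
  move=> /eqP; rewrite mulf_eq0 => /orP [|/eqP ->]; last by rewrite eqxx.
  by rewrite fmorph_eq0 => /eqP.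
have a_0 := c0 _ _ x10 b1; have a_1 := c0 _ _ x20 b2; have a_2 := c0 _ _ x30 b3.
move=> l; have : l \in [:: 0; 1; inord 2].
  by rewrite !inE -!val_eqE /= inordK //; case: l => [[|[|[|]]]].
by rewrite !inE => /or3P [] /eqP ->.
Qed.

End CongruenceSubgroup.

(** * Frobenius powers and the action of the stable letter *)

Section FrobeniusPower.
Variables (L : finFieldType) (p : nat).
Hypothesis pL : p \in [pchar L].

Definition frob_pow (m : nat) (x : L) : L := let _ := pL in x ^+ (p ^ m).

Fact frob_pow_zmod m : zmod_morphism (frob_pow m).
Proof.
move=> x y; have := exprD_pchar_comm m pL (mulrC (x - y) y).
by rewrite subrK /frob_pow => ->; rewrite addrK.
Qed.

Fact frob_pow_monoid m : monoid_morphism (frob_pow m).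
Proof. by split=> [|x y]; rewrite /frob_pow ?expr1n ?exprMn. Qed.

HB.instance Definition _ m := GRing.isZmodMorphism.Build L L (frob_pow m) (frob_pow_zmod m).
HB.instance Definition _ m := GRing.isMonoidMorphism.Build L L (frob_pow m)
  (frob_pow_monoid m).

(** N is the order of the Frobenius map as a permutation of L. *)
Lemma frob_pow_fix : exists N, (0 < N)%N /\ forall x : L, x ^+ (p ^ N) = x.
Proof.
have inj : injective (frob_pow 1) by exact: fmorph_inj.
pose s := perm_of_fun (frob_pow 1).
have sX k x : (s ^+ k)%g x = x ^+ (p ^ k).
  elim: k => [|k IHk]; first by rewrite expg0 perm1 expn0 expr1.
  by rewrite expgSr permM IHk perm_of_funE // /frob_pow expn1 -exprM -expnSr.
by exists #[s]%g; split=> [|x]; rewrite ?order_gt0 // -sX expg_order perm1.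
Qed.

Definition frob_mx m (Z : 'M[dual L]_2) : 'M[dual L]_2 := map_mx (dual_map (frob_pow m)) Z.

Lemma frob_mx_inj m : injective (frob_mx m).
Proof.
move=> Z W /matrixP ZW; apply/matrixP => i j; have := ZW i j; rewrite !mxE.
case: (Z i j) (W i j) => a b [c d] [] /= ac bd.
by congr (_, _); exact: (fmorph_inj (frob_pow m)).
Qed.

Lemma frob_mx_conj m D Z : frob_mx m (conj_fun D Z) = conj_fun (frob_mx m D) (frob_mx m Z).
Proof.
rewrite /conj_fun /frob_mx map_mxZ -!mulmxE !map_mxM map_mx_adj det_map_mx.
congr (_ *: _); rewrite /dual_inv /dual_map /=; congr pair; first exact: fmorphV.
by rewrite rmorphM rmorphN fmorphV rmorphXn.
Qed.

End FrobeniusPower.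

(** * Action of the HNN extension and conclusion *)

Lemma word_mx_nseq (X : Type) (S : comNzRingType) (A : X -> 'M[S]_2) J w :
  word_mx A (flatten (nseq J w)) = word_mx A w ^+ J.
Proof.
elim: J => [|J IHJ]; first by rewrite /word_mx big_nil expr0.
by rewrite /= word_mx_cat IHJ exprS.
Qed.

(** The multiplication-table relations hold because h extends to the free group; the conjugation
    relations are the hypothesis on [tau], through words representing theta. *)
Lemma hnn_lift (r : nat) (theta : {multiplicative free_group r -> free_group r})
    (Theta : 'I_r -> word 'I_r) (P : groupType) (h : 'I_r -> P) (tau : P) :
  (forall w, pres_class _ (word_subst Theta w) = theta (pres_class _ w)) ->
  (forall w, tau * word_val h w * tau^-1 = word_val h (word_subst Theta w))%g ->
  exists Phi : {multiplicative hnn theta -> P},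
    forall w, Phi (pres_class _ [:: (Some (pres_class _ w), true)]) = word_val h w.
Proof.
move=> ThetaE tauE.
have [f fE] := @presented_lift 'I_r (fun _ _ => False) P h (fun _ _ => False_ind _).
pose h' (o : option (free_group r)) : P := if o is Some x then f x else tau.
have [u v|Phi PhiE] := @presented_lift _ (hnn_rel theta) P h' _.
  case=> [x y|x]; rewrite /word_val !big_cons !big_nil !mulg1 /letter_val /=.
    by rewrite gmulfM.
  by rewrite -(pres_class_repr x) fE -ThetaE fE -tauE mulgA.
by exists Phi => w; rewrite PhiE /word_val big_seq1 /letter_val /= fE.
Qed.

(** Map the free group to the symmetric group on three points, x0 to one transposition and every
    other generator to another that does not commute with it. *)
Lemma free_words_neq1 (r : nat) (x0 x1 : 'I_r) : x0 != x1 ->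
  let nontriv w := pres_class (fun _ _ : word 'I_r => False) w <> 1%g in
  [/\ forall x, nontriv [:: (x, true)], nontriv [:: (x0, true); (x1, true)]
    & nontriv [:: (x0, true); (x1, true); (x0, false); (x1, false)]].
Proof.
move=> x01 nontriv.
pose s : {perm 'I_3} := tperm 0 1; pose t : {perm 'I_3} := tperm 1 (inord 2).
pose h (x : 'I_r) := if x == x0 then s else t.
have nt w (i : 'I_3) : word_val h w i != i -> nontriv w.
  move=> wi /pres_classP w1.
  have := @word_val_cong _ _ _ h w [::] (fun _ _ => False_ind _) w1.
  by rewrite {2}/word_val big_nil => w1'; move: wi; rewrite w1' perm1 eqxx.
have d01 : (0 : 'I_3) != 1 by [].
have d02 : (0 : 'I_3) != inord 2 by rewrite -val_eqE /= inordK.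
have d12 : (1 : 'I_3) != inord 2 by rewrite -val_eqE /= inordK.
have s0 : s 0 = 1 by exact: tpermL.
have s2 : s (inord 2) = inord 2 by rewrite tpermD.
have t1 : t 1 = inord 2 by exact: tpermL.
have t2 : t (inord 2) = 1 by exact: tpermR.
have hx0 : h x0 = s by rewrite /h eqxx.
have hx1 : h x1 = t by rewrite /h eq_sym (negPf x01).
split=> [x||].
- have [hx|hx] : h x = s \/ h x = t by rewrite /h; case: eqP; [left|right].
    by apply: (nt _ 0); rewrite /word_val big_seq1 /letter_val /= hx s0 eq_sym.
  by apply: (nt _ 1); rewrite /word_val big_seq1 /letter_val /= hx t1 eq_sym.
- apply: (nt _ 0); rewrite /word_val !big_cons big_nil mulg1 /letter_val /= hx0 hx1.
  by rewrite permM s0 t1 eq_sym.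
- apply: (nt _ 0); rewrite /word_val !big_cons big_nil mulg1 /letter_val /= hx0 hx1.
  by rewrite !permM !tpermV s0 t1 s2 t2 eq_sym.
Qed.

Lemma conj_perm_frob (L : finFieldType) p (pL : p \in [pchar L]) m (D : 'M[dual L]_2) :
  (\det D).1 != 0 -> (\det (frob_mx pL m D)).1 != 0 ->
  ((perm_of_fun (frob_mx pL m))^-1 * conj_perm D * perm_of_fun (frob_mx pL m))%g =
  conj_perm (frob_mx pL m D).
Proof.
move=> D0 FD0; have gI := @frob_mx_inj _ _ pL m.
exact: (perm_of_fun_conj (conj_fun_inj D0) gI (conj_fun_inj FD0) (frob_mx_conj pL m D)).
Qed.

Lemma discM_neq0 (R : idomainType) (D : 'M[dual R]_2) : discM D != 0 ->
  disc (\tr D) (\det D) != 0 /\ (\det D).1 != 0.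
Proof.
by rewrite /discM !mulf_eq0 !negb_or => /andP [/andP [dd0 _] d0].
Qed.

(** If the additive commutator of the real parts is singular, the group commutator has trace 2 delta
    and determinant delta^2, with delta = det A det B on real parts; so its discriminant
    vanishes. *)
Lemma disc_commutator (R : comNzRingType) (A B : 'M[dual R]_2) :
  disc (\tr (A * B * \adj A * \adj B)) (\det (A * B * \adj A * \adj B)) != 0 ->
  \det (re_mx A * re_mx B - re_mx B * re_mx A) != 0.
Proof.
apply: contra_neq => detN.
have trE : \tr (re_mx A * re_mx B * \adj (re_mx A) * \adj (re_mx B)) =
    2 * (\det (re_mx A) * \det (re_mx B)).
  by apply/eqP; rewrite eq_sym -subr_eq0 -det2_comm detN.
have reE := re_mx_commutator A B.
set C := A * B * \adj A * \adj B in reE *.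
have -> : disc (\tr C) (\det C) = (\tr (re_mx C)) ^+ 2 - 4 * \det (re_mx C).
  by rewrite /disc trace_map_mx det_map_mx.
rewrite reE trE !detM !det2_adj; ring.
Qed.

Theorem theorem5p4 (r : nat) (hr : (2 <= r)%N)
  (theta : {multiplicative free_group r -> free_group r})
  (theta_inj : injective theta)
  (d : int) (hd : (2 <= `|d|)%N)
  (hBS : exists (K : groupClosed (hnn theta))
           (f : {multiplicative baumslag_solitar1 d -> subgroup K}),
           bijective f) :
  exists (H : groupClosed (hnn theta)) (p : nat),
    [/\ finite_index H, prime p & homology_dim_ge (subgroup H) 'F_p 1 3].
Proof.
pose Rel := fun _ _ : word 'I_r => False.
pose cls : word 'I_r -> free_group r := pres_class Rel.
pose Theta (x : 'I_r) : word 'I_r :=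
  generic_quotient.repr (theta (cls [:: (x, true)])).
have ThetaE w : cls (word_subst Theta w) = theta (cls w).
  by apply: word_subst_class => x; exact: pres_class_repr.
pose x0 : 'I_r := Ordinal (ltnW hr); pose x1 : 'I_r := Ordinal hr.
have x01 : x0 != x1 by [].
have [gen_neq1 prod_neq1 comm_neq1] := free_words_neq1 x01.
pose w3 : word 'I_r := [:: (x0, true); (x1, true)].
pose w4 : word 'I_r := [:: (x0, true); (x1, true); (x0, false); (x1, false)].
(* The product supplies the third class, the commutator the invertibility of the additive
   commutator, and the generators make every A x invertible as well as giving the first two
   classes. *)
pose ws := w3 :: w4 :: [seq [:: (x, true)] | x <- enum 'I_r].
have ws_neq1 w : w \in ws -> cls w <> 1%g.
  by rewrite !inE => /or3P [/eqP ->|/eqP ->|/mapP [x _ ->]].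
have iter_neq1 k w : w \in ws -> ~ pres_cong Rel (iter k (word_subst Theta) w) [::].
  (* Injectivity of theta keeps all iterates of a nontrivial word nontrivial. *)
  move=> /ws_neq1 w1 /pres_classP kw; apply: w1.
  elim: k kw => [//|k IHk] /=; rewrite -/(cls _) ThetaE => kw; apply: IHk.
  by apply: theta_inj; rewrite multiplicative1.
have [p [L [iota [m [A [p_pr p_gt2 AE discA]]]]]] := quasi_fixed_matrices iter_neq1.
have pL : p \in [pchar L] by exact/(rmorph_pchar iota)/pchar_Fp.
have [N [N_gt0 expL]] := frob_pow_fix pL.
have p_odd : odd p by case: (even_prime p_pr) p_gt2 => // ->.
have genE := word_mx_letter A.
have discAx x : discM (A x) != 0.
  by rewrite -genE; apply: discA; rewrite !inE map_f ?orbT // mem_enum.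
have A0 x : (\det (A x)).1 != 0 by have [] := discM_neq0 (discAx x).
have wE w := word_conj_perm w A0.
have AF x : word_mx A (Theta x) = frob_mx pL m (A x).
  by apply/matrixP => i j; rewrite AE !mxE.
(* At the quasi-fixed point [Theta x] evaluates to the Frobenius image of A x, so t may act as the
   inverse Frobenius. *)
have [|Phi PhiE] := @hnn_lift r theta Theta {perm 'M[dual L]_2}
    (fun x => conj_perm (A x)) (perm_of_fun (frob_mx pL m))^-1%g ThetaE.
  move=> w; rewrite invgK (wE w).1 (wE (word_subst Theta w)).1.
  have E : word_mx A (word_subst Theta w) = frob_mx pL m (word_mx A w).
    by rewrite word_mx_subst (eq_word_mx w AF) /frob_mx word_mx_map.
  rewrite E; apply: conj_perm_frob; first exact: (wE w).2.
  by rewrite -E; exact: (wE _).2.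
pose J := (((p ^ N) ^ 2).-1)%N.
pose g w : hnn theta := pres_class _ [:: (Some (cls (flatten (nseq J w))), true)].
have gE w : Phi (g w) = conj_perm (word_mx A w ^+ J).
  by rewrite /g PhiE (wE _).1 word_mx_nseq.
have congr_g w : discM (word_mx A w) != 0 -> exists al be, be != 0 /\
    Phi (g w) = conj_perm (1 + eps_mx (al *: 1 + be *: re_mx (word_mx A w))).
  move=> /(mx_pow_congruence pL p_odd N_gt0 expL) [al [be [be0 E]]].
  by exists al, be; rewrite gE -E.
have d3 : discM (word_mx A w3) != 0 by apply: discA; rewrite inE eqxx.
have d4 : discM (word_mx A w4) != 0 by apply: discA; rewrite !inE eqxx orbT.
have d0 : discM (word_mx A [:: (x0, true)]) != 0 by rewrite genE.
have d1 : discM (word_mx A [:: (x1, true)]) != 0 by rewrite genE.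
have [al1 [be1 [be10 E1]]] := congr_g _ d0.
have [al2 [be2 [be20 E2]]] := congr_g _ d1.
have [al3 [be3 [be30 E3]]] := congr_g _ d3.
rewrite genE in E1; rewrite genE in E2.
rewrite word_mx_pair re_mxM in E3.
have detN : \det (re_mx (A x0) * re_mx (A x1) - re_mx (A x1) * re_mx (A x0)) != 0.
  by apply: disc_commutator; rewrite -word_mx_commutator; exact: (discM_neq0 d4).1.
exists (eps_group Phi), p; split=> //; first exact: eps_group_finite_index.
exact: (eps_group_homology iota E1 be10 E2 be20 E3 be30 detN).
Qed.
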